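(* There is a normal vertex-to-vertex tiling $\mathcal{T}$ of the plane $\mathbb{R}^2$ by pairwise non-congruent convex hexagons of unit area. Moreover, $\mathcal{T}$ consists of non-convex 14-gons that are dissected into four distinct hexagons of equal area; that is, there is a collection of non-convex simple 14-gons with pairwise disjoint interiors whose union is $\mathbb{R}^2$, such that each of these 14-gons is the union of four pairwise non-congruent hexagons of $\mathcal{T}$, and every tile of $\mathcal{T}$ arises in this way.
   Context: A tiling of $\mathbb{R}^2$ is a collection $\{T_1, T_2, \ldots\}$ of compact sets $T_i \subset \mathbb{R}^2$ (the tiles) such that the interiors of distinct tiles are disjoint and the union of all tiles equals $\mathbb{R}^2$. A tiling by polygons is vertex-to-vertex if the intersection of any two distinct tiles is either an entire edge of both tiles, or a point, or empty. A tiling is normal if there are real numbers $R > r > 0$ such that (1) each tile contains some ball of radius $r$, and (2) each tile is contained in some ball of radius $R$. *)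

(* Defs.v *)
From HB Require Import structures.
From mathcomp Require Import all_boot all_order all_algebra.
From mathcomp Require Import all_classical all_reals all_analysis.

Set Implicit Arguments.
Unset Strict Implicit.
Unset Printing Implicit Defensive.

Import Order.TTheory GRing.Theory Num.Theory.
Import numFieldNormedType.Exports.

Local Open Scope classical_set_scope.
Local Open Scope ring_scope.

(* The library norm of a product is the sup norm; the plane R * R shares its
   topology, convex and bounded sets, but distances are measured by [edist]. *)
Definition edist {R : realType} (x y : R * R) : R :=
  Num.sqrt ((x.1 - y.1) ^+ 2 + (x.2 - y.2) ^+ 2).

Definition eball {R : realType} (c : R * R) (r : R) : set (R * R) :=
  [set x | edist c x <= r].

(* A distance-preserving self-map of the Euclidean plane is automatically
   bijective. *)
Definition congruent {R : realType} (A B : set (R * R)) : Prop :=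
  exists f : R * R -> R * R,
    (forall x y, edist (f x) (f y) = edist x y) /\ f @` A = B.

Definition area {R : realType} (A : set (R * R)) : \bar R :=
  ((@lebesgue_measure R) \x (@lebesgue_measure R))%E A.

Definition segment {R : realType} (a b : R * R) : set (R * R) :=
  [set (1 - t) *: a + t *: b | t in `[0, 1]%classic].

Section Polygons.
Context {R : realType} {n : nat}.
Implicit Types v : 'I_n -> R * R.

Definition side v (i : 'I_n) : set (R * R) := segment (v i) (v (ordS i)).

Definition outline v : set (R * R) := \bigcup_i side v i.

(* The last clause excludes straight angles, so that the n points are genuine
   corners and the number of vertices and the edges are determined by the
   polygon. *)
Definition simple_outline v : Prop :=
  [/\ (3 <= n)%N,
      injective v,
      forall i, side v i `&` side v (ordS i) = [set v (ordS i)],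
      forall i j, i != j -> j != ordS i -> i != ordS j ->
        side v i `&` side v j = set0
    & forall i, ~ segment (v i) (v (ordS (ordS i))) (v (ordS i))].

(* The curve together with the bounded components of its complement. *)
Definition enclosed v : set (R * R) :=
  outline v `|`
  [set x | (~` outline v) x /\
           bounded_set (connected_component (~` outline v) x)].

Definition polygon_with v (A : set (R * R)) : Prop :=
  simple_outline v /\ A = enclosed v.

End Polygons.

Definition simple_polygon {R : realType} (n : nat) (A : set (R * R)) : Prop :=
  exists v : 'I_n -> R * R, polygon_with v A.

Definition is_edge {R : realType} (A e : set (R * R)) : Prop :=
  exists n (v : 'I_n -> R * R), polygon_with v A /\ exists i, e = side v i.

Definition convex_polygon {R : realType} (n : nat) (A : set (R * R)) : Prop :=
  simple_polygon n A /\ convex_set A.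

Definition nonconvex_polygon {R : realType} (n : nat) (A : set (R * R)) : Prop :=
  simple_polygon n A /\ ~ convex_set A.

(* Tilings are sets of tiles, so "distinct tiles" means unequal sets. *)
Definition tiling {R : realType} (T : set (set (R * R))) : Prop :=
  [/\ countable T,
      forall A, T A -> compact A,
      forall A B, T A -> T B -> A <> B -> A° `&` B° = set0
    & \bigcup_(A in T) A = setT].

Definition vertex_to_vertex {R : realType} (T : set (set (R * R))) : Prop :=
  forall A B, T A -> T B -> A <> B ->
    [\/ is_edge A (A `&` B) /\ is_edge B (A `&` B),
        exists x, A `&` B = [set x]
      | A `&` B = set0].

Definition normal_tiling {R : realType} (T : set (set (R * R))) : Prop :=
  exists r s : R, [/\ 0 < r, r < s,
    forall A, T A -> exists c, eball c r `<=` A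
  & forall A, T A -> exists c, A `<=` eball c s].

Definition pairwise_noncongruent {R : realType} (T : set (set (R * R))) : Prop :=
  forall A B, T A -> T B -> A <> B -> ~ congruent A B.

(* The interiors of the four pieces are disjoint as soon as T is a tiling. *)
Definition dissected_into_four {R : realType} (T : set (set (R * R)))
    (P : set (R * R)) (h : 'I_4 -> set (R * R)) : Prop :=
  [/\ forall i, T (h i),
      forall i j, i != j -> ~ congruent (h i) (h j)
    & P = \bigcup_i h i].

(* Main.v *)
Require Import Defs.
From mathcomp Require Import all_boot all_order all_algebra.
From mathcomp Require Import all_classical all_reals all_analysis.
From mathcomp Require Import measurable_realfun.
From mathcomp Require Import ring lra zify.
Import Order.TTheory GRing.Theory Num.Theory.
Import numFieldNormedType.Exports.
Local Open Scope classical_set_scope.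
Local Open Scope ring_scope.

(** The tiles are hexagons [hex d m n] indexed by pairs of integers.  With
    X = (m + n) / 2 and Y = m - n, the hexagon of index (m, n) has, up to small
    vertical shifts, the corners (X, Y + 1), (X + 1/4, Y), (X + 1/2, Y),
    (X + 3/4, Y + 1), (X + 1/2, Y + 2), (X + 1/4, Y + 2).  Every edge spans
    exactly one column of width 1/4.  The shifts come from turning each edge that
    is horizontal in this description about its midpoint: the left end of the
    bottom edge of (m, n) goes up by a tilt d m n and its right end goes down by
    the same amount.

    Areas.  A hexagon is cut by the two vertical chords at X + 1/4 and X + 1/2
    into a triangle, a trapezoid and a triangle, so its area is one quarter of
    the sum of the two chord lengths.  A tilt adds to one chord what it takes
    from the other, hence all areas stay equal to 1, whatever the tilts are
    ([area_hex]).

    Congruence.  The hexagons are so tall that the diameter is attained by a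
    diagonal between the two horizontal edges, and its square is
    1/16 + (2 + d m n + d (m + 1) (n - 1))^2 ([hex_diameter]).  The tilts are
    taken to be distinct negative powers of 2: a sum of two distinct powers of 2
    determines them, so the diameter determines the index of the hexagon
    ([tilt_hex_congruent]).

    Tiling.  Bounding boxes show that two hexagons can meet only if their indices
    are neighbours in the honeycomb ([hex_meet]); neighbours lie on opposite sides
    of the line through their common edge, so they share exactly that edge
    ([hex_nb]).  On a vertical line, the heights at which the bottom edges, or
    the upper left edges, of a diagonal of hexagons cross it stay close to an
    arithmetic progression, so every point of the line lies between two
    consecutive ones ([hex_cover]).

    Fourteen-gons.  Group the indices into blocks {p, p + 1} x {q, q + 1} ([block]) with p
    and q even.  The four hexagons of a block surround the common edge of two of
    them, and their union is star-shaped with respect to the midpoint of that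
    edge, because a segment from this midpoint can enter the two outer hexagons
    only through the two inner ones ([gon_star]).  The union without the
    fourteen outer edges is open, being the complement of the union of the other
    tiles ([gon_outline]).  For a closed bounded star-shaped set this is enough to
    be the set enclosed by the curve ([enclosedE]): a component of the
    complement of the curve that meets the open part cannot leave it, and a ray
    pointing away from the centre makes every other component unbounded.  The same
    criterion handles the convex hexagons. *)

Set Implicit Arguments.
Unset Strict Implicit.
Unset Printing Implicit Defensive.

(** * Segments and orientation *)

Section Segments.
Context {R : realType}.
Implicit Types a b c x y z : R * R.

(** Twice the signed area of the triangle a b x, that is, the affine form that
    vanishes on the line a b and is positive to its left. *)
Definition orient a b x : R :=
  (b.1 - a.1) * (x.2 - a.2) - (b.2 - a.2) * (x.1 - a.1).

Lemma segmentP a b x : segment a b x <->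
  exists t, [/\ 0 <= t, t <= 1,
    x.1 = (1 - t) * a.1 + t * b.1 & x.2 = (1 - t) * a.2 + t * b.2].
Proof.
split=> [[t /=]|[t [t0 t1 x1 x2]]].
  by rewrite in_itv /= => /andP[t0 t1] <-; exists t; split.
exists t; first by rewrite /= in_itv /= t0 t1.
by case: x x1 x2 => x1 x2 /= -> ->.
Qed.

Lemma segmentC a b : segment a b = segment b a.
Proof.
by apply/seteqP; split=> x /segmentP[t [t0 t1 x1 x2]]; apply/segmentP;
   exists (1 - t); split; lra.
Qed.

Lemma segment_l a b : segment a b a.
Proof. by apply/segmentP; exists 0; split; lra. Qed.

Lemma segment_r a b : segment a b b.
Proof. by rewrite segmentC; exact: segment_l. Qed.

Definition segment_closed (C : set (R * R)) :=
  forall x y, C x -> C y -> segment x y `<=` C.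

Lemma convex_setP (C : set (R * R)) : convex_set C <-> segment_closed C.
Proof.
split=> [cC x y Cx Cy _ [t /= + <-]|sC x y l].
  rewrite in_itv /= => /andP[t0 t1].
  (* A convex combination weights its first point by the coefficient, [segment]
     its second one. *)
  have h : Itv.spec (@Itv.num_sem R) (Itv.Real `[0%Z, 1%Z]) (1 - t).
    apply/and3P; split; rewrite ?bnd_simp ?num_real //=; lra.
  have := cC x y (Itv.mk h); rewrite !inE => /(_ Cx Cy).
  by rewrite -[X in _ + X *: y](subKr 1 t).
rewrite !inE => Cx Cy; apply: sC Cx Cy _ _; exists (1 - l%:num).
  rewrite /= in_itv /=; have : l%:num <= 1 by []. have : 0 <= l%:num by []. lra.
by rewrite /= subKr.
Qed.

Lemma orient_affine a b x y z t :
  z.1 = (1 - t) * x.1 + t * y.1 -> z.2 = (1 - t) * x.2 + t * y.2 ->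
  orient a b z = (1 - t) * orient a b x + t * orient a b y.
Proof. by rewrite /orient => -> ->; ring. Qed.

(** Away from b, the form of the line a b vanishes on the first segment and has
    the sign of its value at c on the second one. *)
Lemma corner_sides a b c : orient a b c != 0 ->
  segment a b `&` segment b c = [set b].
Proof.
move=> abc; apply/seteqP; split=> [x [/segmentP[t [t0 t1 x1 x2]]]|_ ->]; last first.
  by split; [exact: segment_r|exact: segment_l].
move=> /segmentP[s [s0 s1 y1 y2]] /=.
have /eqP : s * orient a b c = 0.
  rewrite /orient.
  have -> : s * ((b.1 - a.1) * (c.2 - a.2) - (b.2 - a.2) * (c.1 - a.1)) =
    (b.1 - a.1) * ((1 - s) * b.2 + s * c.2 - a.2)
    - (b.2 - a.2) * ((1 - s) * b.1 + s * c.1 - a.1) by ring.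
  by rewrite -y1 -y2 x1 x2; ring.
rewrite mulf_eq0 (negPf abc) orbF => /eqP s00.
by rewrite [x]surjective_pairing [b]surjective_pairing y1 y2 s00; congr pair; ring.
Qed.

Lemma corner_not_straight a b c : orient a b c != 0 -> ~ segment a c b.
Proof.
move=> abc /segmentP[t [t0 t1 b1 b2]].
have := orient_affine a b b1 b2.
have -> : orient a b b = 0 by rewrite /orient; ring.
have -> : orient a b a = 0 by rewrite /orient; ring.
move/esym/eqP; rewrite mulr0 add0r mulf_eq0 (negPf abc) orbF => /eqP t00.
case/negP: abc; apply/eqP; rewrite /orient b1 b2 t00; ring.
Qed.

Lemma continuous_orient a b : continuous (orient a b : R * R -> R).
Proof.
move=> x; rewrite /orient.
by apply: cvgB; (apply: cvgM; first exact: cvg_cst);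
  (apply: cvgB; last exact: cvg_cst); [exact: cvg_snd|exact: cvg_fst].
Qed.

Lemma open_orient_gt0 a b : open [set x | 0 < orient a b x].
Proof.
by apply: (open_comp _ (@open_gt R 0)) => x _; exact: continuous_orient.
Qed.

Lemma closed_orient_ge0 a b : closed [set x | 0 <= orient a b x].
Proof.
by apply: (closed_comp _ (@closed_ge R 0)) => x _; exact: continuous_orient.
Qed.

End Segments.

(** * The set enclosed by a star-shaped outline *)

Section Enclosure.
Context {R : realType}.
Implicit Types (A C : set (R * R)) (x y z o : R * R).

Definition boxed A := exists M : R, forall x, A x -> `|x.1| <= M /\ `|x.2| <= M.

Lemma boxed_bounded A : boxed A -> bounded_set A.
Proof.
case=> M AM; exists M; split; first exact: num_real.
move=> N MN x /AM[x1 x2] /=.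
by rewrite prod_normE /= ge_max !(le_trans _ (ltW MN)).
Qed.

Lemma boxed_compact A : closed A -> boxed A -> compact A.
Proof.
move=> cA [M AM]; apply: (@subclosed_compact _ _ (`[-M, M] `*` `[-M, M])) => //.
  by apply: compact_setX; exact: segment_compact.
by move=> x /AM[]; rewrite !ler_norml => ? ?; split; rewrite /= in_itv.
Qed.

(** The value at parameter t is b + (t - 1) (b - a), so its absolute value
    grows at least like (t - 1) |b - a|. *)
Lemma line_unbounded (M a b : R) : a <> b ->
  exists2 t, 1 <= t & M < `|(1 - t) * a + t * b|.
Proof.
move=> ab.
have ba0 : 0 < `|b - a| by rewrite normr_gt0 subr_eq0; apply/eqP => /esym.
exists (1 + (`|M| + 2 * `|b| + 1) / `|b - a|).
  by rewrite lerDl divr_ge0 // !addr_ge0 // mulr_ge0.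
set u := _ / _; have u0 : 0 <= u by rewrite divr_ge0 // !addr_ge0 // mulr_ge0.
have ub : u * `|b - a| = `|M| + 2 * `|b| + 1 by rewrite divfK ?gt_eqF.
have -> : (1 - (1 + u)) * a + (1 + u) * b = u * (b - a) - - b by ring.
apply: lt_le_trans (lerB_dist _ _); rewrite normrM (ger0_norm u0) ub normrN.
have := ler_norm M; have := normr_ge0 b; lra.
Qed.

Lemma ray_unbounded o x A : x <> o ->
  (forall t, 1 <= t -> A ((1 - t) *: o + t *: x)) -> ~ bounded_set A.
Proof.
move=> xo Aray [M [_ AM]].
have {AM}AM y : A y -> `|y.1| <= `|M| + 1 /\ `|y.2| <= `|M| + 1.
  have MM : M < `|M| + 1 by rewrite (le_lt_trans (ler_norm _)) ?ltrDl.
  by move=> /(AM _ MM) /=; rewrite prod_normE /= ge_max => /andP.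
case: (eqVneq o.1 x.1) => [x1|/eqP/(line_unbounded (`|M| + 1))[t t1 big]].
  case: (eqVneq o.2 x.2) => [x2|/eqP/(line_unbounded (`|M| + 1))[t t1 big]].
    by apply: xo; rewrite (surjective_pairing x) (surjective_pairing o) x1 x2.
  by move: big; rewrite ltNge; case/negP; case: (AM _ (Aray t t1)).
by move: big; rewrite ltNge; case/negP; case: (AM _ (Aray t t1)).
Qed.

Lemma ray_connected o x :
  connected [set (1 - t) *: o + t *: x | t in [set t : R | 1 <= t]].
Proof.
apply: connected_continuous_connected.
  apply/connected_intervalP => a b /= a1 _ z /andP[az _]; exact: le_trans az.
apply: continuous_subspaceT => t.
apply: cvgD; apply: cvgZr_tmp; last exact: cvg_id.
by apply: cvgB; [exact: cvg_cst|exact: cvg_id].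
Qed.

(** A component of the complement of the outline that starts inside A stays in
    the relatively open and closed part A \ outline, so it is bounded.  A
    component that starts at a point x outside A contains the part beyond x of the
    ray from o through x: a point of A on it would force x into A by
    star-shapedness. *)
Lemma enclosedE n (v : 'I_n -> R * R) A o :
  closed A -> boxed A -> outline v `<=` A -> open (A `\` outline v) ->
  A o -> (forall x, A x -> segment o x `<=` A) -> enclosed v = A.
Proof.
move=> cA bA vA oA Ao star; apply/seteqP; split=> x.
  case=> [/vA //|[nx]]; apply: contraPP => nAx.
  apply: (@ray_unbounded o x); first by move=> xo; apply: nAx; rewrite xo.
  pose B := [set (1 - t) *: o + t *: x | t in [set t : R | 1 <= t]].
  suff BC : B `<=` connected_component (~` outline v) x.
    by move=> t t1; apply: BC; exists t.
  apply: connected_component_max; last exact: ray_connected.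
    by exists 1 => //=; rewrite subrr scale0r add0r scale1r.
  move=> _ [t /= t1 <-] /vA/star; apply: contra_not nAx; apply.
  have t0 : 0 < t by exact: lt_le_trans t1.
  exists t^-1; first by rewrite /= in_itv /= invr_ge0 ltW //= invf_le1.
  have t0' : t != 0 by rewrite gt_eqF.
  by case: (o) (x) => [a1 a2] [b1 b2]; congr pair; rewrite /= /GRing.scale /=; field.
move=> Ax; have [|nx] := pselect (outline v x); [by left|right; split=> //].
apply: boxed_bounded; case: bA => M AM; exists M => y Cy; apply: AM.
pose C := connected_component (~` outline v) x.
suff e : C = C `&` (A `\` outline v).
  by have : C y by []; rewrite e; case=> _ [].
have /(_ (C `&` (A `\` outline v))) := @component_connected _ (~` outline v) x.
move=> h; apply/esym/h.
- by exists x; split=> //; exact: connected_component_refl.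
- by exists (A `\` outline v).
- exists A => //; apply/seteqP; split=> z [Cz]; first by case.
  by move=> Az; split=> //; split=> //; exact: connected_component_sub Cz.
Qed.

End Enclosure.

(** * Strictly convex polygons *)

Section ConvexPolygons.
Context {R : realType} {n : nat}.
Implicit Types (v : 'I_n -> R * R) (i j : 'I_n) (x y z : R * R).

Definition edge_form v i : R * R -> R := orient (v i) (v (ordS i)).

Definition region v : set (R * R) := [set x | forall i, 0 <= edge_form v i x].

(** Vertices are listed counterclockwise: each vertex lies strictly to the left of
    every edge that it does not belong to. *)
Definition strictly_convex v :=
  forall i j, j != i -> j != ordS i -> 0 < edge_form v i (v j).

Lemma ordS_neq i : (1 < n)%N -> ordS i != i.
Proof.
move=> n1; rewrite -val_eqE /=; have := ltn_ord i.
rewrite leq_eqVlt => /orP[/eqP e|h]; last by rewrite modn_small //; lia.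
by rewrite e modnn; lia.
Qed.

Lemma ordSS_neq i : (2 < n)%N -> ordS (ordS i) != i.
Proof.
move=> n2; rewrite -val_eqE /= -addn1 modnDml addn1; have := ltn_ord i.
case: (ltnP i.+2 n) => h lt; first by rewrite modn_small //; lia.
have -> : (i.+2 = n + (i.+2 - n))%N by lia.
by rewrite modnDl modn_small; lia.
Qed.

Lemma edge_form_l v i : edge_form v i (v i) = 0.
Proof. by rewrite /edge_form /orient; ring. Qed.

Lemma edge_form_r v i : edge_form v i (v (ordS i)) = 0.
Proof. by rewrite /edge_form /orient; ring. Qed.

Lemma edge_form_side v i x : side v i x -> edge_form v i x = 0.
Proof.
case/segmentP=> t [_ _ x1 x2]; rewrite /edge_form (orient_affine _ _ x1 x2).
by rewrite -/(edge_form v i _) edge_form_l -/(edge_form v i _) edge_form_r; ring.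
Qed.

Lemma segment_edge_form_ge0 v i x y z : segment x y z ->
  0 <= edge_form v i x -> 0 <= edge_form v i y -> 0 <= edge_form v i z.
Proof.
move=> /segmentP[t [t0 t1 z1 z2]] x0 y0.
by rewrite /edge_form (orient_affine _ _ z1 z2) addr_ge0 ?mulr_ge0 //; lra.
Qed.

Lemma region_segment_closed v : segment_closed (region v).
Proof. by move=> x y Hx Hy z xyz i; apply: segment_edge_form_ge0 xyz _ _. Qed.

Lemma region_closed v : closed (region v).
Proof.
rewrite (_ : region v = \bigcap_(i in setT) [set x | 0 <= edge_form v i x]).
  by apply: closed_bigI => i _; exact: closed_orient_ge0.
by apply/seteqP; split=> x Hx i; [move=> _|]; exact: Hx.
Qed.

Lemma interior_region_open v : open [set x | forall i, 0 < edge_form v i x].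
Proof.
rewrite openE => x Hx; apply: (@filter_forall _ _ (fun i x => 0 < edge_form v i x) (nbhs x) _) => i.
by have := @open_orient_gt0 R (v i) (v (ordS i)); rewrite openE => /(_ x (Hx i)).
Qed.

Context (n2 : (2 < n)%N) (v : 'I_n -> R * R) (cv : strictly_convex v).

Lemma vertex_in_region j : region v (v j).
Proof.
move=> i; have [->|ji] := eqVneq j i; first by rewrite edge_form_l.
have [->|jsi] := eqVneq j (ordS i); first by rewrite edge_form_r.
exact/ltW/cv.
Qed.

Lemma side_sub_region i : side v i `<=` region v.
Proof. exact: region_segment_closed (vertex_in_region _) (vertex_in_region _). Qed.

(** On the line of an edge, the forms of the preceding and the following edge
    are affine coordinates that vanish at the two end points; their being
    nonnegative confines x to the segment.  The parameter of x on the segment is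
    the normalised value of the preceding form. *)
Lemma region_on_side i x : region v x -> edge_form v i x = 0 -> side v i x.
Proof.
move=> Hx x0.
set j := ordS i; set k := ord_pred i.
have Sk : ordS k = i by rewrite /k ord_predK.
have ij : j != i by apply: ordS_neq; lia.
have ji : 0 < edge_form v j (v i).
  by apply: cv; rewrite eq_sym //; exact: ordSS_neq.
have kj : 0 < edge_form v k (v j).
  apply: cv; last by rewrite Sk.
  by rewrite /j -{1}Sk; exact: ordSS_neq.
set E := edge_form v k (v j) in kj; pose t := edge_form v k x / E.
have tE : t * E = edge_form v k x by rewrite divfK ?gt_eqF.
have E0 : E != 0 by rewrite gt_eqF.
have xk : edge_form v k x = (v i - v k).1 * (x - v i).2 - (v i - v k).2 * (x - v i).1.
  by rewrite /edge_form Sk /orient /=; ring.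
have Ek : E = (v i - v k).1 * (v j - v i).2 - (v i - v k).2 * (v j - v i).1.
  by rewrite /E /edge_form Sk /orient /=; ring.
have xi : (v j - v i).1 * (x - v i).2 = (v j - v i).2 * (x - v i).1.
  by apply/eqP; rewrite -subr_eq0; apply/eqP; exact: x0.
have x1 : x.1 = (1 - t) * (v i).1 + t * (v j).1.
  apply: (mulfI E0); rewrite -[LHS](subrK (E * (v i).1)) -mulrBr.
  have -> : E * (x.1 - (v i).1) = edge_form v k x * (v j - v i).1.
    apply/eqP; rewrite -subr_eq0 xk Ek; apply/eqP.
    transitivity ((v i - v k).1 * ((v j - v i).2 * (x - v i).1 - (v j - v i).1 * (x - v i).2)).
      by rewrite /=; ring.
    by rewrite xi subrr mulr0.
  by rewrite -tE /=; ring.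
have x2 : x.2 = (1 - t) * (v i).2 + t * (v j).2.
  apply: (mulfI E0); rewrite -[LHS](subrK (E * (v i).2)) -mulrBr.
  have -> : E * (x.2 - (v i).2) = edge_form v k x * (v j - v i).2.
    apply/eqP; rewrite -subr_eq0 xk Ek; apply/eqP.
    transitivity ((v i - v k).2 * ((v j - v i).2 * (x - v i).1 - (v j - v i).1 * (x - v i).2)).
      by rewrite /=; ring.
    by rewrite xi subrr mulr0.
  by rewrite -tE /=; ring.
apply/segmentP; exists t; split=> //; first by rewrite divr_ge0 ?(ltW kj).
have := Hx j; rewrite /edge_form (orient_affine _ _ x1 x2).
rewrite -/(edge_form v j _) -[X in _ + t * X]/(edge_form v j (v j)) edge_form_l.
by rewrite mulr0 addr0 pmulr_lge0 // subr_ge0.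
Qed.

Lemma outline_region :
  region v `\` outline v = [set x | forall i, 0 < edge_form v i x].
Proof.
apply/seteqP; split=> [x [Hx nx] i|x Hx]; last first.
  by split=> [i|[i _ /edge_form_side xi]]; [exact/ltW|have := Hx i; rewrite xi ltxx].
rewrite lt_neqAle Hx andbT; apply/eqP => /esym xi.
by apply: nx; exists i => //; exact: region_on_side.
Qed.

Lemma strictly_convex_injective : injective v.
Proof.
move=> i j vij; apply/eqP/negPn/negP => ij.
have [e|sij] := eqVneq j (ordS i); last first.
  have := cv _ sij; rewrite eq_sym => /(_ ij).
  by rewrite -vij edge_form_l ltxx.
have := @cv j i ij; rewrite {1}e eq_sym => /(_ (ordSS_neq _ n2)).
by rewrite vij edge_form_l ltxx.
Qed.

Lemma strictly_convex_corner i :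
  0 < orient (v i) (v (ordS i)) (v (ordS (ordS i))).
Proof.
apply: cv; first exact: ordSS_neq.
by apply: ordS_neq; lia.
Qed.

Lemma strictly_convex_simple : simple_outline v.
Proof.
split=> //; first exact: strictly_convex_injective.
- by move=> i; apply: corner_sides; rewrite gt_eqF ?strictly_convex_corner.
- move=> i j ij jsi isj; rewrite -subset0 => x [/edge_form_side + /segmentP[t]].
  move=> x0 [t0 t1 x1 x2]; have := x0; rewrite /edge_form (orient_affine _ _ x1 x2).
  have a : 0 < orient (v i) (v (ordS i)) (v j) by apply: cv; rewrite // eq_sym.
  have b : 0 < orient (v i) (v (ordS i)) (v (ordS j)).
    apply: cv; first by rewrite eq_sym.
    by rewrite (inj_eq (@ordS_inj _)) eq_sym.
  apply/eqP; rewrite gt_eqF //; have [->|t00] := eqVneq t 0; first lra.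
  have := mulr_gt0 (_ : 0 < t) b; have := mulr_ge0 (_ : 0 <= 1 - t) (ltW a).
  by rewrite lt_neqAle eq_sym t00 t0 subr_ge0 => /(_ t1) + /(_ isT); lra.
- by move=> i; apply: corner_not_straight; rewrite gt_eqF ?strictly_convex_corner.
Qed.

End ConvexPolygons.

(** * Convex hulls and segments leaving a convex polygon *)

Section Hull.
Context {R : realType}.
Implicit Types (C : set (R * R)) (p q r x y z : R * R).

Lemma segment_closed_bary2 C p q a b x : segment_closed C -> C p -> C q ->
  0 <= a -> 0 <= b -> 0 < a + b ->
  (a + b) * x.1 = a * p.1 + b * q.1 -> (a + b) * x.2 = a * p.2 + b * q.2 -> C x.
Proof.
move=> sC Cp Cq a0 b0 ab0 x1 x2; apply: (sC _ _ Cp Cq).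
have ab : a + b != 0 by rewrite gt_eqF.
apply/segmentP; exists (b / (a + b)); split; first by rewrite divr_ge0 // ltW.
- by rewrite ler_pdivrMr // mul1r lerDr.
- by apply: (mulfI ab); rewrite x1; field.
- by apply: (mulfI ab); rewrite x2; field.
Qed.

Lemma segment_closed_bary3 C p q r a b c x : segment_closed C ->
  C p -> C q -> C r -> 0 <= a -> 0 <= b -> 0 <= c -> 0 < a + b + c ->
  (a + b + c) * x.1 = a * p.1 + b * q.1 + c * r.1 ->
  (a + b + c) * x.2 = a * p.2 + b * q.2 + c * r.2 -> C x.
Proof.
move=> sC Cp Cq Cr a0 b0 c0 s0 x1 x2.
have [ab|ab] := eqVneq (a + b) 0.
  have /andP[/eqP a00 /eqP b00] : (a == 0) && (b == 0) by rewrite -paddr_eq0 ?ab.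
  apply: (segment_closed_bary2 (p := r) (q := r) sC Cr Cr c0 (lexx 0)).
  - by lra.
  - by move: x1; rewrite a00 b00; lra.
  - by move: x2; rewrite a00 b00; lra.
have ab0 : 0 < a + b by rewrite lt_neqAle eq_sym ab addr_ge0.
pose y := ((a * p.1 + b * q.1) / (a + b), (a * p.2 + b * q.2) / (a + b)).
have Cy : C y by apply: (segment_closed_bary2 sC Cp Cq a0 b0 ab0); rewrite /= mulrC divfK ?gt_eqF.
apply: (segment_closed_bary2 sC Cy Cr (ltW ab0) c0 s0).
- by rewrite x1 /y /= [X in _ = X + _]mulrC divfK ?gt_eqF.
- by rewrite x2 /y /= [X in _ = X + _]mulrC divfK ?gt_eqF.
Qed.

(** Fan triangulation from vertex 0: x is to the left of the line from vertex 0
    to vertex 1 and to the right of the line from vertex 0 to the last vertex, so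
    for some k it is between the lines to the vertices k and k + 1.  Then it lies
    in the triangle of the vertices 0, k, k + 1, and the values of the three
    forms are its barycentric coordinates. *)
Lemma region_hull n (v : 'I_n -> R * R) C : (2 < n)%N -> strictly_convex v ->
  segment_closed C -> (forall i, C (v i)) -> region v `<=` C.
Proof.
case: n v => [//|n] v n2 cv sC Cv x Hx.
pose w k : R * R := v (inord k); pose g k := orient (w 0%N) (w k) x.
have wS k : (k < n)%N -> ordS (inord k) = inord k.+1 :> 'I_n.+1.
  by move=> kn; apply: val_inj; rewrite /= !inordK ?modn_small //; lia.
have wn : ordS (inord n) = inord 0 :> 'I_n.+1.
  by apply: val_inj; rewrite /= !inordK ?modnn.
have g1 : 0 <= g 1%N.
  by have := Hx (inord 0); rewrite /edge_form wS; last lia.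
have gn : g n <= 0.
  have := Hx (inord n); rewrite /edge_form wn -/(w n) -/(w 0%N) /g /orient; lra.
have ex : exists k, (0 < k)%N && (g k.+1 <= 0).
  by exists n.-1; rewrite prednK ?gn ?andbT; lia.
case: (ex_minnP ex) => k /andP[k0 gk1] kmin.
have kn : (k < n)%N.
  have : (k <= n.-1)%N by apply: kmin; rewrite prednK ?gn ?andbT; lia.
  lia.
have gk : 0 <= g k.
  case: k k0 {gk1 kn} kmin => [//|[//|k]] _ kmin.
  by rewrite leNgt; apply/negP => /ltW gk; have := kmin k.+1; rewrite gk => /(_ isT); lia.
have ck : 0 <= orient (w k) (w k.+1) x.
  by have := Hx (inord k); rewrite /edge_form wS.
have D0 : 0 < orient (w k) (w k.+1) (w 0%N).
  have := cv (inord k) (inord 0); rewrite /edge_form wS //.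
  by apply; rewrite -val_eqE /= !inordK; lia.
apply: (segment_closed_bary3 (p := w 0%N) (q := w k) (r := w k.+1) (b := - g k.+1)
  (c := g k) sC (Cv _) (Cv _) (Cv _) ck) => //; rewrite ?oppr_ge0 //.
- rewrite (_ : _ + _ + _ = orient (w k) (w k.+1) (w 0%N)) //.
  by rewrite /g /orient; ring.
- by rewrite /g /orient; ring.
- by rewrite /g /orient; ring.
Qed.

Context {n : nat} (n2 : (2 < n)%N) (v : 'I_n -> R * R) (cv : strictly_convex v).

Lemma region_boxed : boxed (region v).
Proof.
pose M := \sum_i (`|(v i).1| + `|(v i).2|).
exists M => x.
move: x; apply: (region_hull (C := [set y | `|y.1| <= M /\ `|y.2| <= M]) n2 cv).
- move=> y z /= [y1 y2] [z1 z2] u /segmentP[t [t0 t1 u1 u2]].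
  have t2 : 0 <= 1 - t by rewrite subr_ge0.
  rewrite /= u1 u2; split; apply: (le_trans (ler_normD _ _));
    rewrite !normrM (ger0_norm t0) (ger0_norm t2).
    by have := ler_wpM2l t0 z1; have := ler_wpM2l t2 y1; lra.
  by have := ler_wpM2l t0 z2; have := ler_wpM2l t2 y2; lra.
- move=> i; rewrite /M (bigD1 i) //=.
  have : 0 <= \sum_(j | j != i) (`|(v j).1| + `|(v j).2|).
    by apply: sumr_ge0 => j _; rewrite addr_ge0.
  by have := normr_ge0 (v i).1; have := normr_ge0 (v i).2; lra.
Qed.

Lemma region_compact : compact (region v).
Proof. by apply: boxed_compact; [exact: region_closed|exact: region_boxed]. Qed.

Lemma polygon_with_region : polygon_with v (region v).
Proof.
split; first exact: strictly_convex_simple.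
have n0 : (0 < n)%N by lia.
apply/esym/(@enclosedE _ _ _ _ (v (Ordinal n0))).
- exact: region_closed.
- exact: region_boxed.
- by move=> x [i _ /side_sub_region]; apply.
- by rewrite outline_region //; exact: interior_region_open.
- exact: vertex_in_region.
- by move=> x Hx; apply: region_segment_closed => //; exact: vertex_in_region.
Qed.

(** Among the edge forms that are negative at z, the one whose zero on the
    segment is closest to y gives the exit point: there, all the other forms are
    still nonnegative. *)
Lemma region_exit y z : region v y -> ~ region v z ->
  exists i, edge_form v i z < 0 /\ exists2 w, side v i w & segment y z w.
Proof.
move=> Hy /existsNP[i0 /negP]; rewrite -ltNge => i0z.
pose t i := - edge_form v i z / (edge_form v i y - edge_form v i z).
case: (arg_maxP (P := fun i => edge_form v i z < 0) t i0z) => i iz imax.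
have den j : edge_form v j z < 0 -> 0 < edge_form v j y - edge_form v j z.
  by move=> jz; have := Hy j; lra.
have ti0 : 0 <= t i by rewrite /t divr_ge0 ?(ltW (den _ _)) // oppr_ge0 ltW.
have ti1 : t i <= 1 by rewrite ler_pdivrMr ?den // mul1r; have := Hy i; lra.
pose w : R * R := ((1 - t i) * z.1 + t i * y.1, (1 - t i) * z.2 + t i * y.2).
have wE j : edge_form v j w = (1 - t i) * edge_form v j z + t i * edge_form v j y.
  exact: orient_affine.
have tE j : edge_form v j z < 0 ->
    (1 - t j) * edge_form v j z + t j * edge_form v j y = 0.
  by move=> /den jz; rewrite /t; field; rewrite gt_eqF.
exists i; split=> //; exists w; last first.
  by rewrite segmentC; apply/segmentP; exists (t i).
apply: region_on_side => //; last by rewrite wE tE.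
move=> j; rewrite wE; have [jz|jz] := leP 0 (edge_form v j z).
  by rewrite addr_ge0 // mulr_ge0 // subr_ge0.
have := tE _ jz; have := ler_wpM2r (ltW (den _ jz)) (imax j jz); lra.
Qed.

(** If the sides of a convex polygon that hide it from o are each contained in a
    convex set M i that contains o, then o sees the whole polygon inside the union:
    the part of the segment outside the polygon lies between o and the hiding
    side. *)
Lemma region_star o (M : 'I_n -> set (R * R)) :
  (forall i, edge_form v i o < 0 -> [/\ segment_closed (M i), M i o & side v i `<=` M i]) ->
  forall y, region v y ->
    segment o y `<=` region v `|` \bigcup_(i in [set i | edge_form v i o < 0]) M i.
Proof.
move=> oM y Hy z oyz; have [|nz] := pselect (region v z); [by left|right].
have [i [iz [w iw yzw]]] := region_exit Hy nz.
have io : edge_form v i o < 0.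
  rewrite ltNge; apply/negP => io; have := segment_edge_form_ge0 oyz io (Hy i).
  by rewrite leNgt iz.
have [sM Mo iM] := oM _ io.
exists i => //=; apply: (sM _ _ Mo (iM _ iw)).
move: oyz yzw => /segmentP[t [t0 t1 z1 z2]] /segmentP[s [s0 s1 w1 w2]].
have [t00|tn0] := eqVneq t 0.
  apply/segmentP; exists 0; split; rewrite ?z1 ?z2 ?t00 //; lra.
have tp : 0 < t by rewrite lt_neqAle eq_sym tn0.
have d0 : 0 < 1 - s + s * t.
  have := mulr_ge0 s0 t0; have [->|sn1] := eqVneq s 1; first by lra.
  have : s < 1 by rewrite lt_neqAle sn1. lra.
apply/segmentP; exists (t / (1 - s + s * t)); split.
- by rewrite divr_ge0 // ltW.
- rewrite ler_pdivrMr // mul1r -subr_ge0.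
  rewrite (_ : _ - t = (1 - s) * (1 - t)); last by ring.
  by rewrite mulr_ge0 // subr_ge0.
- by rewrite w1 z1; field; rewrite gt_eqF.
- by rewrite w2 z2; field; rewrite gt_eqF.
Qed.

(** Moving slightly towards a fixed interior point c makes all forms
    positive. *)
Lemma region_interior_dense c x (U : set (R * R)) : (forall i, 0 < edge_form v i c) ->
  region v x -> open U -> U x -> exists2 y, U y & forall i, 0 < edge_form v i y.
Proof.
move=> c0 Hx oU Ux.
pose f (t : R) : R * R := (1 - t) *: x + t *: c.
have cf : continuous f.
  move=> t; apply: cvgD; apply: cvgZr_tmp; last exact: cvg_id.
  by apply: cvgB; [exact: cvg_cst|exact: cvg_id].
have f0 : f 0 = x by rewrite /f subr0 scale1r scale0r addr0.
have : \forall t \near (0 : R), U (f t).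
  by apply: cf; rewrite f0; exact: open_nbhs_nbhs.
case/nbhs_ballP => e /= e0 eU.
pose t := Num.min (e / 2) 1.
have t0 : 0 < t by rewrite lt_min divr_gt0 //=.
have t1 : t <= 1 by rewrite ge_min lexx orbT.
exists (f t).
  apply: eU; rewrite /ball /= sub0r normrN (gtr0_norm t0).
  by rewrite /t gt_min ltr_pdivrMr // ltr_pMr ?ltr1n.
move=> i; rewrite /edge_form (@orient_affine _ _ _ x c _ t) //.
apply: ltr_wpDl; first by apply: mulr_ge0; [rewrite subr_ge0|have := Hx i].
by rewrite mulr_gt0 //; exact: c0.
Qed.

End Hull.

(** * The honeycomb of tilted hexagons *)

Section Honeycomb.
Context {R : realType}.
Implicit Types (d : int -> int -> R) (m n : int) (i j : 'I_6) (x y z : R * R).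

(** Counterclockwise from the leftmost vertex.  The edge from vertex 1 to vertex 2
    is turned about its midpoint by d m n; the edge from vertex 4 to vertex 5 is
    the bottom edge of the hexagon above, of index (m + 1, n - 1), and is turned
    by the tilt of that index. *)
Definition hex_vertex d m n (i : 'I_6) : R * R :=
  let X := (m + n)%:~R / 2 in let Y := (m - n)%:~R in
  match val i with
  | 0%N => (X, Y + 1 - d m (n - 1))
  | 1%N => (X + 1 / 4, Y + d m n)
  | 2%N => (X + 1 / 2, Y - d m n)
  | 3%N => (X + 3 / 4, Y + 1 + d (m + 1) n)
  | 4%N => (X + 1 / 2, Y + 2 - d (m + 1) (n - 1))
  | _ => (X + 1 / 4, Y + 2 + d (m + 1) (n - 1))
  end.

Definition hex d m n := region (hex_vertex d m n).

(** Index shifts to the neighbour across side i. *)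
Definition nbm (i : 'I_6) : int := nth 0 [:: -1; -1; 0; 1; 1; 0] i.
Definition nbn (i : 'I_6) : int := nth 0 [:: 0; 1; 1; 0; -1; -1] i.

Lemma ordS_inord k : (k < 5)%N -> ordS (inord k) = inord k.+1 :> 'I_6.
Proof. by move=> k5; apply: val_inj; rewrite /= !inordK ?modn_small //; lia. Qed.

Lemma ordS_inord5 : ordS (inord 5) = inord 0 :> 'I_6.
Proof. by apply: val_inj; rewrite /= !inordK. Qed.

Context (d : int -> int -> R) (d0 : forall m n, 0 < d m n)
  (d8 : forall m n, d m n <= 1 / 8).

Lemma hex_vertex_strictly_convex m n : strictly_convex (hex_vertex d m n).
Proof.
have := d0 m (n - 1); have := d8 m (n - 1); have := d0 m n; have := d8 m n.
have := d0 (m + 1) n; have := d8 (m + 1) n.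
have := d0 (m + 1) (n - 1); have := d8 (m + 1) (n - 1).
move=> h1 h2 h3 h4 h5 h6 h7 h8.
case=> [[|[|[|[|[|[|k]]]]]] hi] //; case=> [[|[|[|[|[|[|l]]]]]] hj] //= _ _.
all: rewrite /edge_form /orient /hex_vertex /=; lra.
Qed.

Let cv := hex_vertex_strictly_convex.

Lemma hex_vertex_box m n i :
  [/\ (m + n)%:~R / 2 <= (hex_vertex d m n i).1,
      (hex_vertex d m n i).1 <= (m + n)%:~R / 2 + 3 / 4,
      (m - n)%:~R - 1 / 8 <= (hex_vertex d m n i).2
    & (hex_vertex d m n i).2 <= (m - n)%:~R + 2 + 1 / 8].
Proof.
have := d0 m (n - 1); have := d8 m (n - 1); have := d0 m n; have := d8 m n.
have := d0 (m + 1) n; have := d8 (m + 1) n.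
have := d0 (m + 1) (n - 1); have := d8 (m + 1) (n - 1).
move=> h1 h2 h3 h4 h5 h6 h7 h8.
by case: i => [[|[|[|[|[|[|k]]]]]] hi] //; split; rewrite /hex_vertex /=; lra.
Qed.

Definition box (a b c e : R) : set (R * R) :=
  [set x | [/\ a <= x.1, x.1 <= b, c <= x.2 & x.2 <= e]].

Lemma box_segment_closed a b c e : segment_closed (box a b c e).
Proof.
move=> x y [x1 x2 x3 x4] [y1 y2 y3 y4] z /segmentP[t [t0 t1 z1 z2]].
have t1' : 0 <= 1 - t by rewrite subr_ge0.
split; rewrite ?z1 ?z2.
- by have := ler_wpM2l t0 y1; have := ler_wpM2l t1' x1; lra.
- by have := ler_wpM2l t0 y2; have := ler_wpM2l t1' x2; lra.
- by have := ler_wpM2l t0 y3; have := ler_wpM2l t1' x3; lra.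
- by have := ler_wpM2l t0 y4; have := ler_wpM2l t1' x4; lra.
Qed.

Lemma hex_box m n : hex d m n `<=`
  box ((m + n)%:~R / 2) ((m + n)%:~R / 2 + 3 / 4)
      ((m - n)%:~R - 1 / 8) ((m - n)%:~R + 2 + 1 / 8).
Proof.
apply: region_hull => //; first exact: box_segment_closed.
by move=> i; exact: hex_vertex_box.
Qed.

(** Side i of a hexagon is side i + 3 of the neighbour across it, traversed
    backwards. *)
Lemma hex_vertex_nb m n i :
  hex_vertex d (m + nbm i) (n + nbn i) (ordS (ordS (ordS i))) = hex_vertex d m n (ordS i) /\
  hex_vertex d (m + nbm i) (n + nbn i) (ordS (ordS (ordS (ordS i)))) = hex_vertex d m n i.
Proof.
by case: i => [[|[|[|[|[|[|k]]]]]] hi] //; rewrite /hex_vertex /nbm /nbn /=;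
  rewrite ?(addr0, subrK, addrK); split; congr pair; field.
Qed.

(** Overlapping bounding boxes leave |dm + dn| <= 1 and |dm - dn| <= 2 for the
    difference (dm, dn) of the indices; by parity these are exactly the differences
    to the six neighbours. *)
Lemma hex_meet m n m' n' x : hex d m n x -> hex d m' n' x ->
  (m, n) <> (m', n') -> exists i, m' = m + nbm i /\ n' = n + nbn i.
Proof.
move=> /hex_box[x1 x2 x3 x4] /hex_box[y1 y2 y3 y4] ne.
have a1 : m' + n' - (m + n) < 2 by rewrite -(ltr_int R) rmorphB /=; lra.
have a2 : m + n - (m' + n') < 2 by rewrite -(ltr_int R) rmorphB /=; lra.
have b1 : m' - n' - (m - n) < 3 by rewrite -(ltr_int R) rmorphB /=; lra.
have b2 : m - n - (m' - n') < 3 by rewrite -(ltr_int R) rmorphB /=; lra.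
have {}ne : ~ (m = m' /\ n = n') by case=> *; apply: ne; congr pair.
have : [\/ m' = m - 1 /\ n' = n, m' = m - 1 /\ n' = n + 1
         | m' = m /\ n' = n + 1] \/
       [\/ m' = m + 1 /\ n' = n, m' = m + 1 /\ n' = n - 1
         | m' = m /\ n' = n - 1].
  have : (m' = m - 1 /\ n' = n \/ m' = m - 1 /\ n' = n + 1
         \/ m' = m /\ n' = n + 1) \/
       (m' = m + 1 /\ n' = n \/ m' = m + 1 /\ n' = n - 1
         \/ m' = m /\ n' = n - 1) by lia.
  by case=> [[?|[?|?]]|[?|[?|?]]]; [left|left|left|right|right|right];
    [constructor 1|constructor 2|constructor 3|constructor 1|constructor 2|constructor 3].
by case=> [[]|[]] [-> ->];
  [exists (inord 0)|exists (inord 1)|exists (inord 2)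
  |exists (inord 3)|exists (inord 4)|exists (inord 5)];
  rewrite /nbm /nbn inordK //= addr0.
Qed.

Lemma edge_form_nb m n i x :
  edge_form (hex_vertex d (m + nbm i) (n + nbn i)) (ordS (ordS (ordS i))) x =
  - edge_form (hex_vertex d m n) i x.
Proof.
by rewrite /edge_form; have [-> ->] := hex_vertex_nb m n i; rewrite /orient; ring.
Qed.

Lemma side_nb m n i :
  side (hex_vertex d (m + nbm i) (n + nbn i)) (ordS (ordS (ordS i))) =
  side (hex_vertex d m n) i.
Proof. by rewrite /side; have [-> ->] := hex_vertex_nb m n i; rewrite segmentC. Qed.

Lemma hex_nb m n i :
  hex d m n `&` hex d (m + nbm i) (n + nbn i) = side (hex_vertex d m n) i.
Proof.
apply/seteqP; split=> x.
  case=> Hx Nx; apply: region_on_side => //.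
  apply/eqP; rewrite eq_le Hx andbT.
  by have := Nx (ordS (ordS (ordS i))); rewrite edge_form_nb oppr_ge0.
move=> xi; split; first exact: side_sub_region xi.
by rewrite -side_nb in xi; exact: side_sub_region xi.
Qed.

Definition hex_center m n : R * R := ((m + n)%:~R / 2 + 3 / 8, (m - n)%:~R + 1).

Lemma hex_center_interior m n i : 0 < edge_form (hex_vertex d m n) i (hex_center m n).
Proof.
have := d0 m (n - 1); have := d8 m (n - 1); have := d0 m n; have := d8 m n.
have := d0 (m + 1) n; have := d8 (m + 1) n.
have := d0 (m + 1) (n - 1); have := d8 (m + 1) (n - 1).
move=> h1 h2 h3 h4 h5 h6 h7 h8.
by case: i => [[|[|[|[|[|[|k]]]]]] hi] //; rewrite /edge_form /orient /hex_vertex /=; lra.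
Qed.

Lemma hex_interiors_disjoint m n m' n' x : (m, n) <> (m', n') ->
  (forall i, 0 < edge_form (hex_vertex d m n) i x) -> ~ hex d m' n' x.
Proof.
move=> ne Hx Nx.
have [i [? ?]] := hex_meet (fun i => ltW (Hx i)) Nx ne; subst m' n'.
have := Hx i; have := Nx (ordS (ordS (ordS i))).
by rewrite edge_form_nb oppr_ge0 leNgt => /negP.
Qed.

(** Two families of hexagons with no common index overlap in a set with empty
    interior: a point of an open set in a hexagon can be moved, inside the open
    set, to the interior of that hexagon, which no other hexagon meets. *)
Lemma hex_open_overlap (I J : set (int * int)) (U : set (R * R)) :
  open U -> U `<=` \bigcup_(p in I) hex d p.1 p.2 ->
  U `<=` \bigcup_(p in J) hex d p.1 p.2 -> U !=set0 -> I `&` J !=set0.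
Proof.
move=> oU UI UJ [x Ux]; have [[m n] Ip Hx] := UI x Ux.
have [y Uy Hy] := region_interior_dense (hex_center_interior m n) Hx oU Ux.
have [[m' n'] Jp Hy'] := UJ y Uy.
have [e|ne] := pselect ((m, n) = (m', n')).
  by exists (m, n); split=> //; rewrite e.
by case: (hex_interiors_disjoint ne Hy).
Qed.

End Honeycomb.

(** * Vertical sections and areas *)

Section Sections.
Context {R : realType}.
Implicit Types (a b : R * R).

Definition line_height a b (u : R) : R := a.2 + (b.2 - a.2) * (u - a.1) / (b.1 - a.1).

Lemma line_height_segment a b u : a.1 < b.1 -> a.1 <= u -> u <= b.1 ->
  segment a b (u, line_height a b u).
Proof.
move=> ab au ub; have ba : b.1 - a.1 != 0 by rewrite subr_eq0 gt_eqF.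
have ba0 : 0 < b.1 - a.1 by rewrite subr_gt0.
apply/segmentP; exists ((u - a.1) / (b.1 - a.1)); split.
- by rewrite divr_ge0 ?subr_ge0 // ltW.
- by rewrite ler_pdivrMr // mul1r lerB.
- by rewrite /=; field.
- by rewrite /line_height /=; field.
Qed.

Lemma line_heightC a b u : a.1 != b.1 -> line_height a b u = line_height b a u.
Proof.
move=> ab; rewrite /line_height; field.
by apply/andP; split; rewrite subr_eq0 // eq_sym.
Qed.

Lemma orient_height a b u w : a.1 != b.1 ->
  orient a b (u, w) = (b.1 - a.1) * (w - line_height a b u).
Proof. by move=> ab; rewrite /orient /line_height /=; field; rewrite subr_eq0 eq_sym. Qed.

Lemma vertical_segment_closed (C : set (R * R)) (u p q w : R) : segment_closed C ->
  C (u, p) -> C (u, q) -> p <= w -> w <= q -> C (u, w).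
Proof.
move=> sC Cp Cq pw wq; apply: (sC _ _ Cp Cq); apply/segmentP.
have [qp|qp] := eqVneq p q.
  by exists 0; split; rewrite /=; lra.
have qp0 : 0 < q - p by rewrite subr_gt0 lt_neqAle qp (le_trans pw).
exists ((w - p) / (q - p)); split.
- by apply: divr_ge0; lra.
- by rewrite ler_pdivrMr //; lra.
- by rewrite /=; ring.
- by rewrite /=; field; rewrite gt_eqF.
Qed.

(** If the side i runs to the right and the side j runs back to the left over
    the same interval of abscissas, they are the lower and the upper boundary of
    the polygon there. *)
Lemma slab_section n (v : 'I_n -> R * R) i j u w : strictly_convex v ->
  (v i).1 < (v (ordS i)).1 -> (v (ordS j)).1 = (v i).1 -> (v j).1 = (v (ordS i)).1 ->
  (v i).1 <= u -> u <= (v (ordS i)).1 ->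
  region v (u, w) <->
    line_height (v i) (v (ordS i)) u <= w /\ w <= line_height (v j) (v (ordS j)) u.
Proof.
move=> cv ii ji jj iu ui; split=> [H|[lo up]]; last first.
  apply: (@vertical_segment_closed (region v) _ _ _ _ _ _ _ lo up).
  - exact: region_segment_closed.
  - exact: (side_sub_region cv (line_height_segment ii iu ui)).
  - apply: (side_sub_region cv (i := j)); rewrite /side segmentC line_heightC.
      by apply: line_height_segment; rewrite ?ji ?jj.
    by rewrite ji jj gt_eqF.
split.
  have := H i; rewrite /edge_form orient_height ?lt_eqF // pmulr_rge0 ?subr_ge0 //.
  by rewrite subr_gt0.
have := H j; rewrite /edge_form orient_height ?ji ?jj ?gt_eqF // nmulr_rge0 ?subr_le0 //.
by rewrite subr_lt0.
Qed.

Local Notation mu := (@lebesgue_measure R).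

Lemma measurable_split (g : R -> \bar R) (a b c : R) : a <= b -> b <= c ->
  measurable_fun `[a, b] g -> measurable_fun `[b, c] g -> measurable_fun `[a, c] g.
Proof.
move=> ab bc mab mbc.
have mbc' : measurable_fun `]b, c] g.
  by apply: measurable_funS mbc => //; exact: subset_itv_oc_cc.
rewrite (_ : `[a, c]%classic = `[a, b] `|` `]b, c]).
  exact/measurable_funU.
by rewrite -itv_bndbnd_setU ?bnd_simp.
Qed.

Lemma integral_split (g : R -> \bar R) (a b c : R) : a <= b -> b <= c ->
  measurable_fun `[a, b] g -> measurable_fun `[b, c] g ->
  (\int[mu]_(x in `[a, c]) g x =
   \int[mu]_(x in `[a, b]) g x + \int[mu]_(x in `[b, c]) g x)%E.
Proof.
move=> ab bc mab mbc.
have mbc' : measurable_fun `]b, c] g.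
  by apply: measurable_funS mbc => //; exact: subset_itv_oc_cc.
rewrite -[in X in (_ + X)%E]integral_itv_obnd_cbnd //.
rewrite -integral_setU //.
- by rewrite -itv_bndbnd_setU ?bnd_simp.
- exact/measurable_funU.
- rewrite disj_set2E; apply/eqP; rewrite -subset0 => x [] /=.
  by rewrite !in_itv /= => /andP[_ xb] /andP[]; rewrite ltNge xb.
Qed.

Lemma integral_affine (a b c e : R) : a < b ->
  (\int[mu]_(x in `[a, b]) (c + e * x)%:E = ((b - a) * (c + e * (a + b) / 2))%:E)%E.
Proof.
move=> ab.
pose F : R -> R := fun x => c * x + e / 2 * x ^+ 2.
have dF (x : R) : is_derive x (1 : R) F (c + e * x).
  have -> : F = c \*: (@id R) + (e / 2) \*: ((@id R) ^+ 2).
    by apply/funext => y; rewrite /F fctE.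
  have -> : c + e * x = c *: (1 : R) + (e / 2) *: ((2%:R * x ^+ 1) *: (1 : R)).
    by rewrite /GRing.scale /=; field.
  exact: is_deriveD.
have cF : continuous F.
  by move=> x; apply/differentiable_continuous/derivable1_diffP;
    exact: (@ex_derive _ _ _ _ _ _ _ (dF x)).
rewrite (@continuous_FTC2 _ _ F) //.
- by rewrite -EFinB /F; congr EFin; field.
- apply: continuous_subspaceT => x; apply: cvgD; first exact: cvg_cst.
  by apply: cvgM; [exact: cvg_cst|exact: cvg_id].
- split; first by move=> x _; exact: (@ex_derive _ _ _ _ _ _ _ (dF x)).
    by apply: cvg_at_right_filter; exact: cF.
  by apply: cvg_at_left_filter; exact: cF.
- by move=> x _; rewrite derive1E; exact: (@derive_val _ _ _ _ _ _ _ (dF x)).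
Qed.

Section SlabArea.
Context {n : nat} (v : 'I_n -> R * R) (cv : strictly_convex v) (i j : 'I_n).
Context (ii : (v i).1 < (v (ordS i)).1) (ji : (v (ordS j)).1 = (v i).1)
  (jj : (v j).1 = (v (ordS i)).1).

Lemma slab_measure u : (v i).1 <= u -> u <= (v (ordS i)).1 ->
  mu (xsection (region v) u) =
  (line_height (v j) (v (ordS j)) u - line_height (v i) (v (ordS i)) u)%:E.
Proof.
move=> iu ui; have sec w := slab_section w cv ii ji jj iu ui.
have [_ lu] := (sec _).1 (side_sub_region cv (line_height_segment ii iu ui)).
have -> : xsection (region v) u =
    `[line_height (v i) (v (ordS i)) u, line_height (v j) (v (ordS j)) u]%classic.
  apply/seteqP; split=> w; rewrite /xsection /= inE in_itv /=.
    by case/sec=> -> ->.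
  by case/andP=> lo up; apply/sec.
rewrite lebesgue_measure_itv /= lte_fin EFinB; case: ltP => [_|ul]; first by [].
rewrite -EFinB.
have -> : line_height (v j) (v (ordS j)) u = line_height (v i) (v (ordS i)) u.
  by apply/eqP; rewrite eq_le ul lu.
by rewrite subrr.
Qed.

(* The length of the vertical section over the slab is the affine function
   c + e u, with slope e. *)
Let e : R := ((v (ordS j)).2 - (v i).2 - ((v j).2 - (v (ordS i)).2))
  / ((v i).1 - (v (ordS i)).1).
Let c : R := (v (ordS j)).2 - (v i).2 - e * (v i).1.

Let slab_affine u : (v i).1 <= u -> u <= (v (ordS i)).1 ->
  mu (xsection (region v) u) = (c + e * u)%:E.
Proof.
move=> iu ui; rewrite slab_measure // /c /e /line_height ji jj; congr EFin; field.
by rewrite !subr_eq0 lt_eqF ?gt_eqF.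
Qed.

Lemma slab_measurable : measurable_fun `[(v i).1, (v (ordS i)).1]
  (fun u => mu (xsection (region v) u)).
Proof.
apply: (@eq_measurable_fun _ _ _ _ _ (fun u => (c + e * u)%:E)).
  by move=> u; rewrite inE /= in_itv /= => /andP[iu ui]; rewrite slab_affine.
apply/measurable_EFinP; apply: measurable_funD; first exact: measurable_cst.
by apply: measurable_funM; [exact: measurable_cst|exact: measurable_id].
Qed.

(** The area of a trapezoid. *)
Lemma slab_area :
  (\int[mu]_(u in `[(v i).1, (v (ordS i)).1]) mu (xsection (region v) u) =
   (((v (ordS i)).1 - (v i).1) *
    (((v (ordS j)).2 - (v i).2) + ((v j).2 - (v (ordS i)).2)) / 2)%:E)%E.
Proof.
transitivity (\int[mu]_(u in `[(v i).1, (v (ordS i)).1]) (c + e * u)%:E)%E.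
  by apply: eq_integral => u; rewrite inE /= in_itv /= => /andP[iu ui]; rewrite slab_affine.
rewrite integral_affine // /c /e; congr EFin; field.
by rewrite subr_eq0 lt_eqF.
Qed.

End SlabArea.

Section HexArea.
Context (d : int -> int -> R) (d0 : forall m n, 0 < d m n)
  (d8 : forall m n, d m n <= 1 / 8).

Lemma area_hex m n : area (hex d m n) = 1%E.
Proof.
have cv := hex_vertex_strictly_convex d0 d8 m n.
set X : R := (m + n)%:~R / 2.
pose g u := mu (xsection (hex d m n) u).
have -> : area (hex d m n) = (\int[mu]_(u in `[X, (X + 3 / 4)%R]) g u)%E.
  rewrite [RHS]integral_mkcond; apply: eq_integral => u _.
  rewrite patchE; case: ifPn => // /negP; rewrite inE /= in_itv /= => nu.
  suff -> : xsection (hex d m n) u = set0 by rewrite measure0.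
  rewrite -subset0 => w; rewrite /xsection /= inE => /(hex_box d0 d8)[x1 x2 _ _].
  by apply: nu; apply/andP.
have lt1 (i : 'I_6) : (i < 3)%N -> (hex_vertex d m n i).1 < (hex_vertex d m n (ordS i)).1.
  by case: i => [[|[|[|i]]] hi] //= _; rewrite /hex_vertex /=; lra.
have v0 : (hex_vertex d m n (inord 0)).1 = X by rewrite /hex_vertex /= inordK.
have v1 : (hex_vertex d m n (inord 1)).1 = X + 1 / 4 by rewrite /hex_vertex /= inordK.
have v2 : (hex_vertex d m n (inord 2)).1 = X + 1 / 2 by rewrite /hex_vertex /= inordK.
have v3 : (hex_vertex d m n (inord 3)).1 = X + 3 / 4 by rewrite /hex_vertex /= inordK.
have slab (k l : 'I_6) : (k < 3)%N -> (hex_vertex d m n (ordS l)).1 = (hex_vertex d m n k).1 ->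
    (hex_vertex d m n l).1 = (hex_vertex d m n (ordS k)).1 ->
    measurable_fun `[(hex_vertex d m n k).1, (hex_vertex d m n (ordS k)).1] g /\
    (\int[mu]_(u in `[(hex_vertex d m n k).1, (hex_vertex d m n (ordS k)).1]) g u =
    (((hex_vertex d m n (ordS k)).1 - (hex_vertex d m n k).1) *
    (((hex_vertex d m n (ordS l)).2 - (hex_vertex d m n k).2)
     + ((hex_vertex d m n l).2 - (hex_vertex d m n (ordS k)).2)) / 2)%:E)%E.
  by move=> k3 h1 h2; split; [exact: (slab_measurable cv (lt1 _ k3) h1 h2)
                          |exact: (slab_area cv (lt1 _ k3) h1 h2)].
have := slab (inord 0) (inord 5); have := slab (inord 1) (inord 4).
have := slab (inord 2) (inord 3).
rewrite ordS_inord5 !ordS_inord // v0 v1 v2 v3 !inordK // /hex_vertex /= !inordK //=.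
move=> /(_ isT erefl erefl)[m3 s3] /(_ isT erefl erefl)[m2 s2] /(_ isT erefl erefl)[m1 s1].
have x01 : X <= X + 1 / 4 by lra.
have x12 : X + 1 / 4 <= X + 1 / 2 by lra.
have x23 : X + 1 / 2 <= X + 3 / 4 by lra.
have x13 : X + 1 / 4 <= X + 3 / 4 by lra.
rewrite (integral_split x01 x13 m1 (measurable_split x12 x23 m2 m3)).
rewrite (integral_split x12 x23 m2 m3).
rewrite s1 s2 s3 -!EFinD; congr EFin; lra.
Qed.

End HexArea.

End Sections.

(** * Diameters and congruence *)

Section Diameter.
Context {R : realType}.
Implicit Types (x y z : R * R).

Definition sqdist x y : R := (x.1 - y.1) ^+ 2 + (x.2 - y.2) ^+ 2.

Lemma sqdist_ge0 x y : 0 <= sqdist x y.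
Proof. by rewrite addr_ge0 ?sqr_ge0. Qed.

Lemma sqdistC x y : sqdist x y = sqdist y x.
Proof. by rewrite /sqdist; ring. Qed.

Lemma edist_sqdist x y x' y' : Defs.edist x y = Defs.edist x' y' -> sqdist x y = sqdist x' y'.
Proof.
by move=> e; rewrite -[LHS]sqr_sqrtr ?sqdist_ge0 // -[RHS]sqr_sqrtr ?sqdist_ge0 //; congr (_ ^+ 2).
Qed.

(** Squared distance is a convex function: the deviation from linearity along the
    segment from x to x' is t (1 - t) times the squared length of that segment. *)
Lemma sqdist_segment_closed y M : segment_closed [set x | sqdist x y <= M].
Proof.
move=> x x' /= xM x'M z /segmentP[t [t0 t1 z1 z2]].
have t1' : 0 <= 1 - t by rewrite subr_ge0.
rewrite /= (_ : sqdist z y = (1 - t) * sqdist x y + t * sqdist x' y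
    - t * (1 - t) * sqdist x x'); last by rewrite /sqdist z1 z2; ring.
have := ler_wpM2l t1' xM; have := ler_wpM2l t0 x'M.
have := mulr_ge0 (mulr_ge0 t0 t1') (sqdist_ge0 x x'); lra.
Qed.

(** A convex function on a polygon is largest at a vertex; this is used for each
    of the two points in turn. *)
Lemma region_diameter n (v : 'I_n -> R * R) M : (2 < n)%N -> strictly_convex v ->
  (forall i j, sqdist (v i) (v j) <= M) ->
  forall x y, region v x -> region v y -> sqdist x y <= M.
Proof.
move=> n2 cv vM x y Hx Hy.
move: x Hx; apply: region_hull (@sqdist_segment_closed _ _) _ => // i.
rewrite /= sqdistC.
move: y Hy; apply: region_hull (@sqdist_segment_closed _ _) _ => // j.
exact: vM.
Qed.

Lemma congruent_sqdist_le (A B : set (R * R)) M : congruent A B ->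
  (forall x y, A x -> A y -> sqdist x y <= M) ->
  forall x y, B x -> B y -> sqdist x y <= M.
Proof.
move=> [f [fd <-]] AM _ _ [x Ax <-] [y Ay <-].
by rewrite (edist_sqdist (fd x y)); exact: AM.
Qed.

Lemma congruent_sqdist_le_sym (A B : set (R * R)) M : congruent A B ->
  (forall x y, B x -> B y -> sqdist x y <= M) ->
  forall x y, A x -> A y -> sqdist x y <= M.
Proof.
move=> [f [fd <-]] BM x y Ax Ay.
by rewrite -(edist_sqdist (fd x y)); apply: BM; [exists x|exists y].
Qed.

Lemma edist_ge x y r : Defs.edist x y <= r -> `|x.1 - y.1| <= r /\ `|x.2 - y.2| <= r.
Proof.
move=> xyr; split; apply: le_trans xyr; rewrite -sqrtr_sqr ler_wsqrtr //.
  by rewrite lerDl sqr_ge0.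
by rewrite lerDr sqr_ge0.
Qed.

Lemma edist_le x y r : 0 <= r -> sqdist x y <= r ^+ 2 -> Defs.edist x y <= r.
Proof.
by move=> r0 xyr; rewrite -(ger0_norm r0) -sqrtr_sqr ler_wsqrtr.
Qed.

Lemma line_height_bounds (a b : R * R) u l h : a.1 < b.1 -> a.1 <= u -> u <= b.1 ->
  l <= a.2 -> l <= b.2 -> a.2 <= h -> b.2 <= h -> l <= line_height a b u /\ line_height a b u <= h.
Proof.
move=> ab au ub la lb ah bh; have := line_height_segment ab au ub.
case/(@box_segment_closed _ (a.1) (b.1) l h a b) => //.
- by split=> //; lra.
- by split=> //; lra.
Qed.

End Diameter.

Section Tiling.
Context {R : realType} (d : int -> int -> R) (d0 : forall m n, 0 < d m n)
  (d8 : forall m n, d m n <= 1 / 8).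
Local Notation v m n k := (hex_vertex d m n (inord k)).

Let cv := hex_vertex_strictly_convex d0 d8.

Lemma hex_vertexE m n : let X : R := (m + n)%:~R / 2 in let Y : R := (m - n)%:~R in
  [/\ v m n 0 = (X, Y + 1 - d m (n - 1)), v m n 1 = (X + 1 / 4, Y + d m n)
    & v m n 2 = (X + 1 / 2, Y - d m n)] /\
  [/\ v m n 3 = (X + 3 / 4, Y + 1 + d (m + 1) n),
     v m n 4 = (X + 1 / 2, Y + 2 - d (m + 1) (n - 1))
   & v m n 5 = (X + 1 / 4, Y + 2 + d (m + 1) (n - 1))].
Proof. by split; split; rewrite /hex_vertex /= inordK. Qed.

(** The alternative separates the ends of the two tilted edges, which are near
    the vertical axis of the hexagon, from the leftmost and the rightmost vertex,
    which are near its middle height. *)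
Lemma hex_vertex_spread m n i :
  [/\ `|(hex_vertex d m n i).1 - ((m + n)%:~R / 2 + 3 / 8)| <= 3 / 8,
      (m - n)%:~R - d m n <= (hex_vertex d m n i).2,
      (hex_vertex d m n i).2 <= (m - n)%:~R + 2 + d (m + 1) (n - 1)
    & `|(hex_vertex d m n i).1 - ((m + n)%:~R / 2 + 3 / 8)| <= 1 / 8 \/
      `|(hex_vertex d m n i).2 - ((m - n)%:~R + 1)| <= 1 / 8].
Proof.
rewrite /hex_vertex !ler_norml.
move: (d0 m (n - 1)) (d8 m (n - 1)) (d0 m n) (d8 m n) (d0 (m + 1) n) (d8 (m + 1) n).
move: (d0 (m + 1) (n - 1)) (d8 (m + 1) (n - 1)).
move: ((m + n)%:~R / 2) (m - n)%:~R => X Y.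
move: (d m (n - 1)) (d m n) (d (m + 1) n) (d (m + 1) (n - 1)).
move=> a b e f h1 h2 h3 h4 h5 h6 h7 h8.
case: i => [[|[|[|[|[|[|k]]]]]] hi] //=; (split; [apply/andP; split; lra|lra|lra|]).
- by right; apply/andP; split; lra.
- by left; apply/andP; split; lra.
- by left; apply/andP; split; lra.
- by right; apply/andP; split; lra.
- by left; apply/andP; split; lra.
- by left; apply/andP; split; lra.
Qed.

(** Either both vertices are near the vertical axis, and then their abscissas
    differ by at most 1/4, or one of them is at middle height, and then the pair
    is too close to compete with the height 2 of the hexagon. *)
Lemma hex_diameter m n x y : hex d m n x -> hex d m n y ->
  sqdist x y <= 1 / 16 + (2 + (d m n + d (m + 1) (n - 1))) ^+ 2.
Proof.
apply: region_diameter => // i j.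
set s := d m n + d (m + 1) (n - 1).
have s0 : 0 < s by rewrite addr_gt0.
suff : (`|(hex_vertex d m n i).1 - (hex_vertex d m n j).1| <= 3 / 4 /\
        `|(hex_vertex d m n i).2 - (hex_vertex d m n j).2| <= 3 / 2) \/
       (`|(hex_vertex d m n i).1 - (hex_vertex d m n j).1| <= 1 / 4 /\
        `|(hex_vertex d m n i).2 - (hex_vertex d m n j).2| <= 2 + s).
  rewrite /sqdist; set p := _.1 - _; set q := _.2 - _.
  rewrite -(real_normK (num_real p)) -(real_normK (num_real q)).
  have a0 := normr_ge0 p; have b0 := normr_ge0 q.
  case=> -[ah bh]; have := ler_pM a0 a0 ah ah; have := ler_pM b0 b0 bh bh;
   rewrite !expr2; first by have := mulr_ge0 (ltW s0) (ltW s0); lra.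
  by lra.
have [xi li ui ti] := hex_vertex_spread m n i.
have [xj lj uj tj] := hex_vertex_spread m n j.
have := d8 m n; have := d8 (m + 1) (n - 1).
move: xi li ui ti xj lj uj tj; rewrite /s !ler_norml.
move: (hex_vertex d m n i) (hex_vertex d m n j) ((m + n)%:~R / 2 + 3 / 8).
move: (m - n)%:~R (d m n) (d (m + 1) (n - 1)).
move=> Y e f u w X /andP[x1 x2] l1 u1 ti /andP[y1 y2] l2 u2 tj e8 f8.
case: ti tj => /andP[t1 t2] [] /andP[r1 r2].
- by right; split; apply/andP; split; lra.
- by left; split; apply/andP; split; lra.
- by left; split; apply/andP; split; lra.
- by left; split; apply/andP; split; lra.
Qed.

Lemma hex_diameter_reached m n :
  sqdist (v m n 2) (v m n 5) = 1 / 16 + (2 + (d m n + d (m + 1) (n - 1))) ^+ 2.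
Proof. by have [[_ _ ->] [_ _ ->]] := hex_vertexE m n; rewrite /sqdist /=; field. Qed.

Lemma hex_congruent m n m' n' : congruent (hex d m n) (hex d m' n') ->
  d m n + d (m + 1) (n - 1) = d m' n' + d (m' + 1) (n' - 1).
Proof.
move=> c.
have h p q : 0 <= 2 + (d p q + d (p + 1) (q - 1)).
  by have := d0 p q; have := d0 (p + 1) (q - 1); lra.
have vert p q k : hex d p q (v p q k) by apply: vertex_in_region.
have := congruent_sqdist_le c (@hex_diameter m n) (vert _ _ 2%N) (vert _ _ 5%N).
have := congruent_sqdist_le_sym c (@hex_diameter m' n') (vert _ _ 2%N) (vert _ _ 5%N).
by rewrite !hex_diameter_reached !lerD2l !ler_sqr ?nnegrE ?h // !lerD2l =>
   a b; apply/eqP; rewrite eq_le a b.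
Qed.

(** The lower sides 0, 1, 2 and the upper sides 5, 4, 3 face each other. *)
Lemma hex_slab m n (i : 'I_6) u w : (i < 3)%N ->
  (m + n)%:~R / 2 + i%:R / 4 <= u -> u <= (m + n)%:~R / 2 + i.+1%:R / 4 ->
  line_height (hex_vertex d m n i) (hex_vertex d m n (ordS i)) u <= w ->
  w <= line_height (hex_vertex d m n (rev_ord i)) (hex_vertex d m n (ordS (rev_ord i))) u ->
  hex d m n (u, w).
Proof.
case: i => [[|[|[|k]]] hk] // _ ku uk lo up;
  apply: ((slab_section w (cv m n) _ _ _ _ _).2 (conj lo up));
  rewrite /hex_vertex /=; move: ku uk; rewrite /=; lra.
Qed.

End Tiling.

(** * The hexagons cover the plane *)

Section Coverage.
Context {R : realType}.

(** The integer part of (w - b) / 2 is off by at most one from the step that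
    contains w. *)
Lemma staircase (s : int -> R) b w : (forall k, `|s k - (2 * k%:~R + b)| <= 1) ->
  exists k, s k <= w /\ w <= s (k + 1).
Proof.
move=> sb; pose k := Num.floor ((w - b) / 2).
have /andP[kl kh] : k%:~R <= (w - b) / 2 < (k + 1)%:~R by exact: floor_itv.
have sk j : 2 * j%:~R + b - 1 <= s j /\ s j <= 2 * j%:~R + b + 1.
  by have := sb j; rewrite ler_norml => /andP[]; lra.
have [wk|kw] := leP (s k) w.
  have [wk1|kw1] := leP w (s (k + 1)); first by exists k.
  exists (k + 1); split; first exact: ltW.
  have [h _] := sk (k + 1 + 1); move: h kh; rewrite !intrD; lra.
exists (k - 1); rewrite subrK; split; last exact: ltW.
by have [_ h] := sk (k - 1); move: h kl; rewrite intrB; lra.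
Qed.

Context (d : int -> int -> R) (d0 : forall m n, 0 < d m n)
  (d8 : forall m n, d m n <= 1 / 8).
Local Notation v m n k := (hex_vertex d m n (inord k)).

Lemma lower_right_height m n u :
  line_height (v m n 2) (v m n 3) u = line_height (v m (n + 1) 5) (v m (n + 1) 0) u.
Proof.
have [[_ _ v2] [v3 _ _]] := hex_vertexE d m n.
have [[w0 _ _] [_ _ w5]] := hex_vertexE d m (n + 1).
have -> : v m (n + 1) 5 = v m n 3 by rewrite w5 v3 addrK; congr pair; field.
have -> : v m (n + 1) 0 = v m n 2 by rewrite w0 v2 addrK; congr pair; field.
by apply: line_heightC; rewrite v2 v3 /=; apply/eqP; lra.
Qed.

Lemma upper_right_height m n u :
  line_height (v m n 3) (v m n 4) u = line_height (v (m + 1) n 0) (v (m + 1) n 1) u.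
Proof.
have [_ [v3 v4 _]] := hex_vertexE d m n.
have [[w0 w1 _] _] := hex_vertexE d (m + 1) n.
have -> : v (m + 1) n 1 = v m n 3 by rewrite w1 v3; congr pair; field.
have -> : v (m + 1) n 0 = v m n 4 by rewrite w0 v4; congr pair; field.
by apply: line_heightC; rewrite v3 v4 /=; apply/eqP; lra.
Qed.

Lemma top_height m n u :
  line_height (v m n 4) (v m n 5) u = line_height (v (m + 1) (n - 1) 1) (v (m + 1) (n - 1) 2) u.
Proof.
have [_ [_ v4 v5]] := hex_vertexE d m n.
have [[_ w1 w2] _] := hex_vertexE d (m + 1) (n - 1).
have -> : v (m + 1) (n - 1) 2 = v m n 4 by rewrite w2 v4; congr pair; field.
have -> : v (m + 1) (n - 1) 1 = v m n 5 by rewrite w1 v5; congr pair; field.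
by apply: line_heightC; rewrite v4 v5 /=; apply/eqP; lra.
Qed.

Lemma rev_inord k : (k < 6)%N -> rev_ord (inord k) = inord (5 - k) :> 'I_6.
Proof. by move=> k6; apply: val_inj; rewrite /= !inordK ?subSS //; lia. Qed.

Lemma hex_left m n u w : (m + n)%:~R / 2 <= u -> u <= (m + n)%:~R / 2 + 1 / 4 ->
  line_height (v m n 0) (v m n 1) u <= w -> w <= line_height (v m n 5) (v m n 0) u ->
  hex d m n (u, w).
Proof.
move=> h1 h2 lo up; apply: (hex_slab d0 d8 (i := inord 0)).
- by rewrite inordK.
- by rewrite inordK //; lra.
- by rewrite inordK //; lra.
- by rewrite ordS_inord.
- by rewrite rev_inord // ordS_inord5.
Qed.

Lemma hex_middle m n u w :
  (m + n)%:~R / 2 + 1 / 4 <= u -> u <= (m + n)%:~R / 2 + 1 / 2 ->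
  line_height (v m n 1) (v m n 2) u <= w -> w <= line_height (v m n 4) (v m n 5) u ->
  hex d m n (u, w).
Proof.
move=> h1 h2 lo up; apply: (hex_slab d0 d8 (i := inord 1)).
- by rewrite inordK.
- by rewrite inordK //; lra.
- by rewrite inordK //; lra.
- by rewrite ordS_inord.
- by rewrite rev_inord // ordS_inord.
Qed.

Lemma hex_right m n u w :
  (m + n)%:~R / 2 + 1 / 2 <= u -> u <= (m + n)%:~R / 2 + 3 / 4 ->
  line_height (v m n 2) (v m n 3) u <= w -> w <= line_height (v m n 3) (v m n 4) u ->
  hex d m n (u, w).
Proof.
move=> h1 h2 lo up; apply: (hex_slab d0 d8 (i := inord 2)).
- by rewrite inordK.
- by rewrite inordK //; lra.
- by rewrite inordK //; lra.
- by rewrite ordS_inord.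
- by rewrite rev_inord // ordS_inord.
Qed.

Lemma bottom_height_bounds m n u :
  (m + n)%:~R / 2 + 1 / 4 <= u -> u <= (m + n)%:~R / 2 + 1 / 2 ->
  (m - n)%:~R - 1 / 8 <= line_height (v m n 1) (v m n 2) u /\
  line_height (v m n 1) (v m n 2) u <= (m - n)%:~R + 1 / 8.
Proof.
have [[_ v1 v2] _] := hex_vertexE d m n; have := d0 m n; have := d8 m n => h1 h2 h3 h4.
by apply: line_height_bounds; rewrite ?v1 ?v2 /=; lra.
Qed.

Lemma upper_left_height_bounds m n u :
  (m + n)%:~R / 2 <= u -> u <= (m + n)%:~R / 2 + 1 / 4 ->
  (m - n)%:~R + 1 / 2 <= line_height (v m n 5) (v m n 0) u /\
  line_height (v m n 5) (v m n 0) u <= (m - n)%:~R + 5 / 2.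
Proof.
have [[v0 _ _] [_ _ v5]] := hex_vertexE d m n.
have := d0 m (n - 1); have := d8 m (n - 1).
have := d0 (m + 1) (n - 1); have := d8 (m + 1) (n - 1) => h1 h2 h3 h4 h5 h6.
rewrite line_heightC; last by rewrite v0 v5 /=; apply/eqP; lra.
by apply: line_height_bounds; rewrite ?v0 ?v5 /=; lra.
Qed.

(** Each column of width 1/4 is crossed either by the bottom edges of one
    diagonal m + n = c, or by the zigzag between the diagonals c - 1 and c.  In the
    second case the upper left edges of the diagonal c form the staircase, and
    the lower left edges cut each step into pieces of two hexagons. *)
Lemma hex_cover x : exists m n, hex d m n x.
Proof.
case: x => u w; pose c := Num.floor (2 * u).
have /andP[cl ch] : c%:~R <= 2 * u < (c + 1)%:~R by exact: floor_itv.
have cE k : (k + (c - k))%:~R = c%:~R :> R by congr _%:~R; ring.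
have cE' k : (k - (c - k))%:~R = 2 * k%:~R - c%:~R :> R by rewrite !intrB; ring.
have kS k : c - (k + 1) = c - k - 1 by ring.
rewrite intrD in ch.
have [uc|cu] := leP u (c%:~R / 2 + 1 / 4).
  have [|k [lo up]] := @staircase
      (fun k => line_height (v k (c - k) 5) (v k (c - k) 0) u) (3 / 2 - c%:~R) w.
    move=> k; have := @upper_left_height_bounds k (c - k) u.
    by rewrite cE cE' ler_norml => h; case: h; lra.
  have [Aw|wA] := leP (line_height (v (k + 1) (c - (k + 1)) 0) (v (k + 1) (c - (k + 1)) 1) u) w.
    by exists (k + 1), (c - (k + 1)); apply: hex_left; rewrite ?cE //; lra.
  exists k, (c - (k + 1)).
  have cE1 : (k + (c - (k + 1)))%:~R = c%:~R - 1 :> R by rewrite !(intrD, intrB); ring.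
  apply: hex_right; rewrite ?cE1; [lra|lra| |].
    by rewrite lower_right_height (_ : c - (k + 1) + 1 = c - k) //; ring.
  by rewrite upper_right_height; exact: ltW.
have [|k [lo up]] := @staircase
    (fun k => line_height (v k (c - k) 1) (v k (c - k) 2) u) (- c%:~R) w.
  move=> k; have := @bottom_height_bounds k (c - k) u.
  by rewrite cE cE' ler_norml => h; case: h; lra.
exists k, (c - k); apply: hex_middle; rewrite ?cE //; [lra|lra|].
by rewrite top_height -kS.
Qed.

Lemma hex_contains_ball m n : eball (hex_center m n) (1 / 8) `<=` hex d m n.
Proof.
case=> u w /edist_ge[]; rewrite /= !ler_norml => /andP[h1 h2] /andP[h3 h4].
have h5 : (m + n)%:~R / 2 + 1 / 4 <= u by lra.
have h6 : u <= (m + n)%:~R / 2 + 1 / 2 by lra.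
apply: hex_middle => //; first by have [_] := bottom_height_bounds h5 h6; lra.
rewrite top_height.
have e1 : (m + 1 + (n - 1))%:~R = (m + n)%:~R :> R by congr _%:~R; ring.
have e2 : (m + 1 - (n - 1))%:~R = (m - n)%:~R + 2 :> R by rewrite !(intrD, intrB); ring.
have := @bottom_height_bounds (m + 1) (n - 1) u; rewrite e1 e2 => /(_ h5 h6)[]; lra.
Qed.

Lemma hex_in_ball m n : hex d m n `<=` eball (hex_center m n) 2.
Proof.
move=> x /(hex_box d0 d8)[h1 h2 h3 h4]; apply: edist_le => //.
set a : R := (hex_center m n).1 - x.1; set b : R := (hex_center m n).2 - x.2.
have : `|a| <= 1 by rewrite ler_norml /a /=; lra.
have : `|b| <= 3 / 2 by rewrite ler_norml /b /=; lra.
rewrite /sqdist -/a -/b -(real_normK (num_real a)) -(real_normK (num_real b)).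
move=> hb ha; have := ler_pM (normr_ge0 a) (normr_ge0 a) ha ha.
have := ler_pM (normr_ge0 b) (normr_ge0 b) hb hb; rewrite !expr2; lra.
Qed.

End Coverage.

(** * Blocks of four hexagons *)

Section Blocks.
Context {R : realType} (d : int -> int -> R) (d0 : forall m n, 0 < d m n)
  (d8 : forall m n, d m n <= 1 / 8).
Let cv := hex_vertex_strictly_convex d0 d8.

Definition block (p q : int) : set (int * int) :=
  [set h | (h.1 = p \/ h.1 = p + 1) /\ (h.2 = q \/ h.2 = q + 1)].

Definition gon p q : set (R * R) := \bigcup_(h in block p q) hex d h.1 h.2.

(** The outline of a block, counterclockwise from its leftmost vertex.  An entry
    (a, b, k) stands for side k of the hexagon of index (p + a, q + b), and also
    for vertex k of it, where that side starts. *)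
Definition gon_table : seq (int * int * nat) :=
  [:: (0, 0, 0%N); (0, 0, 1%N); (0, 1, 0%N); (0, 1, 1%N); (0, 1, 2%N);
      (1, 1, 1%N); (1, 1, 2%N); (1, 1, 3%N); (1, 1, 4%N);
      (1, 0, 3%N); (1, 0, 4%N); (1, 0, 5%N); (0, 0, 4%N); (0, 0, 5%N)].

Definition gon_hex (i : 'I_14) : int * int := (nth (0, 0, 0%N) gon_table i).1.
Definition gon_pos (i : 'I_14) : 'I_6 := inord (nth (0, 0, 0%N) gon_table i).2.

Definition gon_vertex p q (i : 'I_14) : R * R :=
  hex_vertex d (p + (gon_hex i).1) (q + (gon_hex i).2) (gon_pos i).

Lemma gon_vertexS p q i : gon_vertex p q (ordS i) =
  hex_vertex d (p + (gon_hex i).1) (q + (gon_hex i).2) (ordS (gon_pos i)).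
Proof.
by case: i => [[|[|[|[|[|[|[|[|[|[|[|[|[|[|k]]]]]]]]]]]]]] hi] //;
  rewrite /gon_vertex /gon_hex /gon_pos /= ?addr0 ?ordS_inord5 ?ordS_inord //;
  rewrite /hex_vertex /= !inordK //=;
  rewrite ?addrK //; congr pair; field.
Qed.

Lemma side_gon_vertex p q i : side (gon_vertex p q) i =
  side (hex_vertex d (p + (gon_hex i).1) (q + (gon_hex i).2)) (gon_pos i).
Proof. by rewrite /side gon_vertexS. Qed.

Lemma gon_hex_block p q i : block p q (p + (gon_hex i).1, q + (gon_hex i).2).
Proof.
by case: i => [[|[|[|[|[|[|[|[|[|[|[|[|[|[|k]]]]]]]]]]]]]] hi] //;
  rewrite /block /gon_hex /= ?addr0; split; first [by left|by right].
Qed.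

Lemma gon_nb_out p q i : ~ block p q
  (p + (gon_hex i).1 + nbm (gon_pos i), q + (gon_hex i).2 + nbn (gon_pos i)).
Proof.
by case: i => [[|[|[|[|[|[|[|[|[|[|[|[|[|[|k]]]]]]]]]]]]]] hi] //;
  rewrite /block /gon_hex /gon_pos /nbm /nbn /= !inordK //=; lia.
Qed.

(** The table is complete: it lists all sides of the block whose neighbour is
    outside the block. *)
Lemma gon_nb_side p q m n j : block p q (m, n) ->
  ~ block p q (m + nbm j, n + nbn j) ->
  exists i, [/\ m = p + (gon_hex i).1, n = q + (gon_hex i).2 & j = gon_pos i].
Proof.
have listed k (k14 : (k < 14)%N) (h := nth (0, 0, 0%N) gon_table k) :
    m = p + h.1.1 -> n = q + h.1.2 -> val j = h.2 ->
    exists i, [/\ m = p + (gon_hex i).1, n = q + (gon_hex i).2 & j = gon_pos i].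
  move=> mh nh jh; exists (inord k); rewrite /gon_hex /gon_pos inordK //; split=> //.
  by apply: val_inj; rewrite -/h -jh /= inordK.
case=> /= mE nE.
have {}mE : m = p + 0 \/ m = p + 1 by lia.
have {}nE : n = q + 0 \/ n = q + 1 by lia.
case: j listed => [[|[|[|[|[|[|k]]]]]] hj] // listed;
  rewrite /block /nbm /nbn /=; case: mE => mE; case: nE => nE.
all: move=> out; try (by exfalso; apply: out; lia).
all: first [by apply: (listed 0%N) | by apply: (listed 1%N) | by apply: (listed 2%N)
  | by apply: (listed 3%N) | by apply: (listed 4%N) | by apply: (listed 5%N)
  | by apply: (listed 6%N) | by apply: (listed 7%N) | by apply: (listed 8%N)
  | by apply: (listed 9%N) | by apply: (listed 10%N) | by apply: (listed 11%N)
  | by apply: (listed 12%N) | by apply: (listed 13%N)].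
Qed.

Lemma finite_set_int (N : nat) : finite_set [set m : int | `|m| <= N%:Z].
Proof.
apply: (sub_finite_set _ (finite_image (fun k : nat => k%:Z - N%:Z) (finite_II (N + N).+1))).
move=> m /= mN; exists (absz (m + N%:Z)); first by rewrite /=; lia.
lia.
Qed.

(** Only finitely many hexagons meet a bounded neighbourhood of a given point. *)
Lemma hexes_closed (I : set (int * int)) : closed (\bigcup_(h in I) hex d h.1 h.2).
Proof.
rewrite -[X in closed X]setCK; apply: open_closedC; rewrite openE => x nx.
pose B : set (R * R) := [set y | `|y.1 - x.1| < 1 /\ `|y.2 - x.2| < 1].
have xB : nbhs x B.
  apply/nbhs_ballP; exists 1 => //= y [].
  by rewrite /ball /= (distrC x.1) (distrC x.2).
pose F := I `&` [set h : int * int | hex d h.1 h.2 `&` B !=set0].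
have finF : finite_set F.
  pose K := `|x.1| + `|x.2| + 10; pose N := Num.bound K.
  have K0 : 0 <= K by rewrite !addr_ge0.
  have KN : K < N%:R by exact: archi_boundP.
  have bnd (m : int) : `|m%:~R : R| <= K -> `|m| <= N%:Z.
    by move=> mK; rewrite -(ler_int R) intr_norm ltW // (le_lt_trans mK).
  apply: (sub_finite_set _ (finite_setX (finite_set_int N) (finite_set_int N))).
  move=> [m n] [_ [y [/(hex_box d0 d8)[h1 h2 h3 h4] [y1 y2]]]] /=.
  move: h1 h2 h3 h4 y1 y2; rewrite /= intrD intrB !ltr_norml.
  move=> h1 h2 h3 h4 /andP[h5 h6] /andP[h7 h8].
  have := ler_norm x.1; have := ler_norm x.2; have := ler_norm (- x.1); have := ler_norm (- x.2).
  rewrite !normrN => k1 k2 k3 k4.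
  by split; apply: bnd; rewrite ler_norml /K; apply/andP; split; lra.
have : nbhs x (~` \bigcup_(h in F) hex d h.1 h.2).
  apply: open_nbhs_nbhs; split.
    apply: closed_openC; apply: closed_bigcup => // h _; exact: region_closed.
  by move=> [h [Ih _] hx]; apply: nx; exists h.
move=> nF; near=> y.
have By : B y by near: y.
have Fy : (~` \bigcup_(h in F) hex d h.1 h.2) y by near: y.
by move=> [h Ih hy]; apply: Fy; exists h => //; split=> //; exists y.
Unshelve. all: by end_near.
Qed.

Lemma gon_boxed p q : boxed (gon p q).
Proof.
exists (`|p%:~R| + `|q%:~R| + 10) => x [[m n] [/= mp nq]] /(hex_box d0 d8)[].
rewrite intrD intrB => h1 h2 h3 h4.
have m1 : p%:~R <= m%:~R :> R by rewrite ler_int; lia.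
have m2 : m%:~R <= p%:~R + 1 :> R by rewrite -[1]/(1%:~R) -intrD ler_int; lia.
have n1 : q%:~R <= n%:~R :> R by rewrite ler_int; lia.
have n2 : n%:~R <= q%:~R + 1 :> R by rewrite -[1]/(1%:~R) -intrD ler_int; lia.
have := ler_norm (p%:~R : R); have := ler_norm (q%:~R : R).
have := ler_norm (- p%:~R : R); have := ler_norm (- q%:~R : R).
rewrite !normrN => k1 k2 k3 k4; rewrite !ler_norml.
by split; apply/andP; split; lra.
Qed.

(** A point of the block that belongs to another tile lies on a side shared with
    a tile outside the block, hence on the outline, and conversely. *)
Lemma gon_outline p q : gon p q `\` outline (gon_vertex p q) =
  ~` \bigcup_(h in ~` block p q) hex d h.1 h.2.
Proof.
apply/seteqP; split=> x.
  case=> -[[m n] mn Hx] nx [[m' n'] mn' Hx'].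
  have [e|j [e1 e2]] := hex_meet d0 d8 Hx Hx'.
    by apply: mn'; rewrite -e.
  rewrite /= in e1 e2; subst m' n'.
  have [i [mE nE jE]] := gon_nb_side mn mn'.
  apply: nx; exists i => //; rewrite side_gon_vertex -mE -nE -jE.
  by rewrite -hex_nb.
move=> nx; split.
  have [m [n Hx]] := hex_cover d0 d8 x.
  have [mn|mn] := pselect (block p q (m, n)); first by exists (m, n).
  by case: nx; exists (m, n).
move=> [i _]; rewrite side_gon_vertex => xi; apply: nx.
exists (p + (gon_hex i).1 + nbm (gon_pos i), q + (gon_hex i).2 + nbn (gon_pos i)).
  exact: gon_nb_out.
by move: xi; rewrite -hex_nb // => -[].
Qed.

(** The midpoint of the edge shared by the upper and the lower hexagon of the
    block.  It does not depend on the tilt of this edge. *)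
Definition gon_center p q : R * R := ((p + q)%:~R / 2 + 7 / 8, (p - q)%:~R + 1).

Lemma gon_center_side p q : side (hex_vertex d (p + 1) q) (inord 1) (gon_center p q).
Proof.
have [[_ v1 v2] _] := hex_vertexE d (p + 1) q.
apply/segmentP; exists (1 / 2); rewrite ordS_inord // v1 v2 /gon_center /=.
by rewrite !(intrD, intrB); split; lra.
Qed.

Lemma gon_center_upper_lower p q :
  hex d (p + 1) q (gon_center p q) /\ hex d p (q + 1) (gon_center p q).
Proof.
have := @gon_center_side p q; rewrite -hex_nb // => -[hB].
by rewrite /nbm /nbn inordK //= addrK.
Qed.

(** The left (c = 0) and the right (c = 1) hexagon of the block are hidden from
    the centre only by their sides towards the upper and the lower hexagon. *)
Lemma gon_center_transparent p q (c : int) i : c = 0 \/ c = 1 ->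
  edge_form (hex_vertex d (p + c) (q + c)) i (gon_center p q) < 0 ->
  block p q (p + c + nbm i, q + c + nbn i) /\
  hex d (p + c + nbm i) (q + c + nbn i) (gon_center p q).
Proof.
have [oB oC] := gon_center_upper_lower p q.
case=> ->; rewrite ?addr0.
  have := d0 p (q - 1); have := d8 p (q - 1); have := d0 p q; have := d8 p q.
  have := d0 (p + 1) q; have := d8 (p + 1) q.
  have := d0 (p + 1) (q - 1); have := d8 (p + 1) (q - 1).
  move=> h1 h2 h3 h4 h5 h6 h7 h8.
  case: i => [[|[|[|[|[|[|k]]]]]] hi] //.
  - by rewrite /edge_form /orient /hex_vertex /gon_center /=; lra.
  - by rewrite /edge_form /orient /hex_vertex /gon_center /=; lra.
  - by move=> _; rewrite /block /nbm /nbn /= addr0; split=> //; split; lia.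
  - by move=> _; rewrite /block /nbm /nbn /= addr0; split=> //; split; lia.
  - by rewrite /edge_form /orient /hex_vertex /gon_center /=; lra.
  - by rewrite /edge_form /orient /hex_vertex /gon_center /=; lra.
have := d0 (p + 1) (q + 1 - 1); have := d8 (p + 1) (q + 1 - 1).
have := d0 (p + 1) (q + 1); have := d8 (p + 1) (q + 1).
have := d0 (p + 1 + 1) (q + 1); have := d8 (p + 1 + 1) (q + 1).
have := d0 (p + 1 + 1) (q + 1 - 1); have := d8 (p + 1 + 1) (q + 1 - 1).
move=> h1 h2 h3 h4 h5 h6 h7 h8.
case: i => [[|[|[|[|[|[|k]]]]]] hi] //.
- by move=> _; rewrite /block /nbm /nbn /= addr0 addrK; split=> //; split; lia.
- by rewrite /edge_form /orient /hex_vertex /gon_center /= ?(intrB, intrD); lra.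
- by rewrite /edge_form /orient /hex_vertex /gon_center /= ?(intrB, intrD); lra.
- by rewrite /edge_form /orient /hex_vertex /gon_center /= ?(intrB, intrD); lra.
- by rewrite /edge_form /orient /hex_vertex /gon_center /= ?(intrB, intrD); lra.
- by move=> _; rewrite /block /nbm /nbn /= addr0 addrK; split=> //; split; lia.
Qed.

(** The centre belongs to the convex upper and lower hexagons, and the left and
    right hexagons are hidden only behind those. *)
Lemma gon_star p q x : gon p q x -> segment (gon_center p q) x `<=` gon p q.
Proof.
have [oB oC] := gon_center_upper_lower p q.
have ends c : c = 0 \/ c = 1 -> hex d (p + c) (q + c) x ->
    segment (gon_center p q) x `<=` gon p q.
  move=> c01 Hx z xz.
  have prem i : edge_form (hex_vertex d (p + c) (q + c)) i (gon_center p q) < 0 ->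
      let M := hex d (p + c + nbm i) (q + c + nbn i) in
      [/\ segment_closed M, M (gon_center p q) & side (hex_vertex d (p + c) (q + c)) i `<=` M].
    move=> io; have [ci iz] := gon_center_transparent c01 io.
    split=> //; first exact: region_segment_closed.
    by move=> y; rewrite -hex_nb // => -[].
  have [Hz|[i /= io iz]] := region_star (n := 6) isT (cv _ _) prem Hx xz.
    by exists (p + c, q + c) => //; rewrite /block /=; lia.
  by have [ci _] := gon_center_transparent c01 io; exists (p + c + nbm i, q + c + nbn i).
case=> -[m n] [/= mE nE] /= Hx; case: mE Hx => ->; case: nE => -> Hx.
- by apply: (ends 0); rewrite ?addr0; [left|].
- move=> z /(region_segment_closed oC Hx) Hz; exists (p, q + 1) => //.
  by rewrite /block /=; lia.
- move=> z /(region_segment_closed oB Hx) Hz; exists (p + 1, q) => //.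
  by rewrite /block /=; lia.
- by apply: (ends 1) => //; right.
Qed.

Lemma gon_enclosed p q : enclosed (gon_vertex p q) = gon p q.
Proof.
apply: (@enclosedE _ _ _ _ (gon_center p q)).
- exact: hexes_closed.
- exact: gon_boxed.
- move=> x [i _]; rewrite side_gon_vertex => /(side_sub_region (cv _ _)) xi.
  by exists (p + (gon_hex i).1, q + (gon_hex i).2) => //; exact: gon_hex_block.
- by rewrite gon_outline; apply: closed_openC; exact: hexes_closed.
- by exists (p + 1, q); [rewrite /block /=; lia|case: (gon_center_upper_lower p q)].
- exact: gon_star.
Qed.

End Blocks.

(** * The outline of a block *)

Section GonOutline.
Context {R : realType} (d : int -> int -> R) (d0 : forall m n, 0 < d m n)
  (d8 : forall m n, d m n <= 1 / 8).
Let cv := hex_vertex_strictly_convex d0 d8.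

(** The corners of the outline for zero tilts, in units of (1/4, 1) and relative
    to (X, Y - 1) for the left hexagon of the block.  The true corners have the
    same abscissas and differ by at most 1/8 in height, so integer comparisons in
    this table decide all incidences of the outline. *)
Definition ideal_table : seq (nat * nat) :=
  [:: (0, 2); (1, 1); (2, 1); (3, 0); (4, 0); (5, 1); (6, 1); (7, 2); (6, 3);
      (5, 3); (4, 4); (3, 4); (2, 3); (1, 3)]%N.
Definition ideal (i : 'I_14) : nat * nat := nth (0, 0)%N ideal_table i.

Lemma ideal_inj : injective ideal.
Proof.
move=> i j /eqP; have lt (k : 'I_14) : (k < size ideal_table)%N by exact: ltn_ord.
by rewrite /ideal nth_uniq // => /eqP; exact: val_inj.
Qed.

Lemma gon_vertex_near p q i :
  (gon_vertex d p q i).1 = (p + q)%:~R / 2 + (ideal i).1%:R / 4 /\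
  `|(gon_vertex d p q i).2 - ((p - q)%:~R - 1 + (ideal i).2%:R)| <= 1 / 8.
Proof.
have b m n : `|d m n| <= 1 / 8 by rewrite gtr0_norm.
case: i => [[|[|[|[|[|[|[|[|[|[|[|[|[|[|k]]]]]]]]]]]]]] hi] //;
  rewrite /gon_vertex /gon_hex /gon_pos /hex_vertex /ideal /= !inordK //= ?addr0 ?(intrB, intrD);
  (split; first by lra).
all: match goal with |- context [d ?m ?n] => move: (b m n); rewrite !ler_norml; lra end.
Qed.

(** At zero tilts the orientations, in units of 1/4, are nonzero integers;
    the tilts change them by at most 1/2. *)
Lemma gon_vertex_corner p q i :
  orient (gon_vertex d p q i) (gon_vertex d p q (ordS i))
    (gon_vertex d p q (ordS (ordS i))) != 0.
Proof.
have [a1 a2] := gon_vertex_near p q i; have [b1 b2] := gon_vertex_near p q (ordS i).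
have [c1 c2] := gon_vertex_near p q (ordS (ordS i)).
rewrite /orient a1 b1 c1; move: a2 b2 c2; rewrite !ler_norml.
move: (gon_vertex d p q i).2 (gon_vertex d p q (ordS i)).2.
move: (gon_vertex d p q (ordS (ordS i))).2 => c a b.
move: ((p + q)%:~R / 2) (p - q)%:~R => X Y {a1 b1 c1}.
case: i => [[|[|[|[|[|[|[|[|[|[|[|[|[|[|k]]]]]]]]]]]]]] hi] //; rewrite /ideal /=;
 move=> /andP[h1 h2] /andP[h3 h4] /andP[h5 h6]; apply/eqP; lra.
Qed.

Lemma gon_vertex_inj p q : injective (gon_vertex d p q).
Proof.
move=> i j ij; apply: ideal_inj.
have [a1 a2] := gon_vertex_near p q i; have [b1 b2] := gon_vertex_near p q j.
rewrite ij in a1 a2.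
have e1 : (ideal i).1 = (ideal j).1.
  by apply/eqP; rewrite -(eqr_nat R); apply/eqP; lra.
have e2 : (ideal i).2 = (ideal j).2.
  move: a2 b2; rewrite !ler_norml => /andP[h1 h2] /andP[h3 h4].
  apply/eqP; rewrite eqn_leq; apply/andP.
  by split; rewrite -ltnS -(ltr_nat R) -natr1; lra.
by rewrite [LHS]surjective_pairing e1 e2 -surjective_pairing.
Qed.

(** The column of a side, with its heights at the left and at the right border of
    the column. *)
Definition ideal_side (i : 'I_14) : nat * nat * nat :=
  let a := ideal i in let b := ideal (ordS i) in
  if (a.1 < b.1)%N then (a.1, a.2, b.2) else (b.1, b.2, a.2).

(** A criterion for two sides to remain disjoint under small vertical shifts of
    their ends; sides whose columns are not adjacent satisfy it trivially.  When
    the columns are adjacent it only looks at the case where s is on the left,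
    and the other case is covered by exchanging s and t. *)
Definition apart (s t : nat * nat * nat) : bool :=
  if s.1.1 == t.1.1 then
    (s.1.2 < t.1.2)%N && (s.2 < t.2)%N || (t.1.2 < s.1.2)%N && (t.2 < s.2)%N
  else (s.1.1.+1 == t.1.1) ==> (s.2 != t.1.2).

Lemma ideal_sides_apart (i j : 'I_14) : i != j -> j != ordS i -> i != ordS j ->
  apart (ideal_side i) (ideal_side j).
Proof.
by case: i => [[|[|[|[|[|[|[|[|[|[|[|[|[|[|k]]]]]]]]]]]]]] hi] //;
   case: j => [[|[|[|[|[|[|[|[|[|[|[|[|[|[|l]]]]]]]]]]]]]] hj] //.
Qed.

(** All heights are integers, so sides that are apart are at distance at least 1
    over each common abscissa. *)
Lemma apart_heights (s t : nat * nat * nat) (r u : R) :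
  apart s t -> apart t s -> 0 <= r -> r <= 1 -> 0 <= u -> u <= 1 ->
  s.1.1%:R + r = t.1.1%:R + u ->
  1 / 4 < `|((1 - r) * s.1.2%:R + r * s.2%:R) - ((1 - u) * t.1.2%:R + u * t.2%:R)|.
Proof.
have nat_lt (a b : nat) : (a < b)%N -> 1 <= b%:R - a%:R :> R.
  by rewrite -(ler_nat R) -natr1; lra.
have nat_neq (a b : nat) : a != b -> 1 <= `|a%:R - b%:R| :> R.
  rewrite neq_ltn => /orP[] /nat_lt h; first by rewrite distrC (le_trans h) ?ler_norm.
  by rewrite (le_trans h) ?ler_norm.
case: s t => [[c l] h] [[c' l'] h']; rewrite /apart /=.
have [-> + _ r0 r1 u0 u1 ru|ne] := eqVneq c c'; last first.
  move=> st ts r0 r1 u0 u1 ru.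
  move: ne; rewrite neq_ltn => /orP[cc|cc].
    have c1 := nat_lt _ _ cc.
    have r11 : r = 1 by lra.
    have u00 : u = 0 by lra.
    have /nat_neq hn : h != l'.
      have e : c.+1 = c' by apply/eqP; rewrite -(eqr_nat R) -natr1; apply/eqP; lra.
      by rewrite e eqxx in st.
    by apply: lt_le_trans (_ : 1 <= _); [lra|rewrite r11 u00; move: hn; congr (_ <= `|_|); ring].
  have c1 := nat_lt _ _ cc.
  have r00 : r = 0 by lra.
  have u11 : u = 1 by lra.
  have /nat_neq hn : h' != l.
    have e : c'.+1 = c by apply/eqP; rewrite -(eqr_nat R) -natr1; apply/eqP; lra.
    by rewrite e eqxx in ts.
  by apply: lt_le_trans (_ : 1 <= _); [lra|rewrite r00 u11 distrC; move: hn; congr (_ <= `|_|); ring].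
have -> : u = r by lra.
have q0 : 0 <= 1 - r by lra.
case/orP=> /andP[/nat_lt ll /nat_lt hh]; have := ler_wpM2l q0 ll; have := ler_wpM2l r0 hh.
  by rewrite distrC => k1 k2; apply: lt_le_trans (ler_norm _); lra.
by move=> k1 k2; apply: lt_le_trans (ler_norm _); lra.
Qed.

Lemma gon_side_near p q i x : side (gon_vertex d p q) i x ->
  exists r, let s := ideal_side i in
  [/\ 0 <= r, r <= 1, x.1 = (p + q)%:~R / 2 + (s.1.1%:R + r) / 4
    & `|x.2 - ((p - q)%:~R - 1 + ((1 - r) * s.1.2%:R + r * s.2%:R))| <= 1 / 8].
Proof.
have col : `|(ideal i).1%:R - (ideal (ordS i)).1%:R| = 1 :> R.
  by case: i => [[|[|[|[|[|[|[|[|[|[|[|[|[|[|k]]]]]]]]]]]]]] hi] //;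
    rewrite /ideal /=; apply/eqP; rewrite eqr_norml ?ler01 andbT; apply/orP;
    first [by left; apply/eqP; ring|by right; apply/eqP; ring].
have [a1 a2] := gon_vertex_near p q i; have [b1 b2] := gon_vertex_near p q (ordS i).
move=> /segmentP[t [t0 t1 x1 x2]].
have t2 : 0 <= 1 - t by lra.
move: a2 b2; rewrite !ler_norml => /andP[h1 h2] /andP[h3 h4].
have near : `|x.2 - ((p - q)%:~R - 1 +
    ((1 - t) * (ideal i).2%:R + t * (ideal (ordS i)).2%:R))| <= 1 / 8.
  rewrite ler_norml x2.
  have := ler_wpM2l t0 h3; have := ler_wpM2l t0 h4.
  have := ler_wpM2l t2 h1; have := ler_wpM2l t2 h2.
  by move=> k1 k2 k3 k4; apply/andP; split; lra.
rewrite a1 b1 in x1; rewrite /ideal_side.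
case: ltnP => /= [lt|ge]; [exists t|exists (1 - t)].
  have e : (ideal (ordS i)).1%:R = (ideal i).1%:R + 1 :> R.
    by move: col lt; rewrite -(ltr_nat R) => + lt; rewrite ltr0_norm ?subr_lt0 //; lra.
  by split=> //; rewrite x1 e; field.
have e : (ideal i).1%:R = (ideal (ordS i)).1%:R + 1 :> R.
  by move: col ge; rewrite -(ler_nat R) => + ge; rewrite ger0_norm ?subr_ge0 //; lra.
split=> //; [lra|by rewrite x1 e; field|].
by move: near; congr (`|_| <= _); ring.
Qed.

Lemma gon_sides_disjoint p q (i j : 'I_14) : i != j -> j != ordS i -> i != ordS j ->
  side (gon_vertex d p q) i `&` side (gon_vertex d p q) j = set0.
Proof.
move=> ij jsi isj; rewrite -subset0 => x [].
case/gon_side_near=> r [r0 r1 x1 x2] /gon_side_near[u [u0 u1 y1 y2]].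
have ap := ideal_sides_apart ij jsi isj.
have ap' : apart (ideal_side j) (ideal_side i) by apply: ideal_sides_apart; rewrite // eq_sym.
have := apart_heights ap ap' r0 r1 u0 u1.
have /[swap]/[apply] : (ideal_side i).1.1%:R + r = (ideal_side j).1.1%:R + u :> R by lra.
apply/negP; rewrite -leNgt; move: x2 y2; rewrite !ler_norml => /andP[h1 h2] /andP[h3 h4].
by apply/andP; split; lra.
Qed.

Lemma gon_vertex_simple p q : simple_outline (gon_vertex d p q).
Proof.
split=> //; first exact: gon_vertex_inj.
- by move=> i; apply/corner_sides/gon_vertex_corner.
- by move=> i j; exact: gon_sides_disjoint.
- by move=> i; apply/corner_not_straight/gon_vertex_corner.
Qed.

Lemma gon_polygon p q : simple_polygon 14 (gon d p q).
Proof.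
exists (gon_vertex d p q); split; first exact: gon_vertex_simple.
by rewrite gon_enclosed.
Qed.

(** The midpoint of the top left vertices of the left and the upper hexagon lies
    in the interior of the tile that fills the notch between these two
    hexagons. *)
Lemma gon_nonconvex p q : ~ convex_set (gon d p q).
Proof.
move=> /convex_setP cg.
have [_ [_ _ v5]] := hex_vertexE d p q; have [_ [_ _ w5]] := hex_vertexE d (p + 1) q.
set a := hex_vertex d p q (inord 5) in v5; set b := hex_vertex d (p + 1) q (inord 5) in w5.
have ga : gon d p q a.
  by exists (p, q); [rewrite /block /=; lia|exact: vertex_in_region].
have gb : gon d p q b.
  by exists (p + 1, q); [rewrite /block /=; lia|exact: vertex_in_region].
pose c : R * R := ((p + q)%:~R / 2 + 1 / 2, (a.2 + b.2) / 2).
have abc : segment a b c.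
  apply/segmentP; exists (1 / 2); rewrite /c /= v5 w5 /= !(intrB, intrD).
  by split; lra.
have [[m n] [/= mp nq] /= Hc] := cg _ _ ga gb _ abc.
apply: (@hex_interiors_disjoint _ _ d0 d8 (p + 1) (q - 1) m n c) => //.
  by case=> ? ?; lia.
have := d0 (p + 1) (q - 1 - 1); have := d8 (p + 1) (q - 1 - 1).
have := d0 (p + 1) (q - 1); have := d8 (p + 1) (q - 1).
have := d0 (p + 1 + 1) (q - 1); have := d8 (p + 1 + 1) (q - 1).
have := d0 (p + 1 + 1) (q - 1 - 1); have := d8 (p + 1 + 1) (q - 1 - 1).
move=> h1 h2 h3 h4 h5 h6 h7 h8 i; rewrite /c v5 w5 /=.
case: i => [[|[|[|[|[|[|k]]]]]] hi] //; rewrite /edge_form /orient /hex_vertex /= ?(intrB, intrD).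
all: lra.
Qed.

End GonOutline.

(** * Tilts with distinct pairwise sums, and the tiling *)

Section PowerSums.

Lemma pow2V_lt (R : realFieldType) (a b : nat) : (a < b)%N ->
  2 * (2^-1 : R) ^+ b <= 2^-1 ^+ a.
Proof.
case: b => // b ab; rewrite exprS mulrA divff ?mul1r ?pnatr_eq0 //.
by rewrite ler_wiXn2l // ?invr_ge0 ?invf_le1 ?ler1n.
Qed.

Lemma pow2V_sum_lt (R : realFieldType) (a b c e : nat) : (a < c)%N -> (c < e)%N ->
  (2^-1 : R) ^+ c + 2^-1 ^+ e < 2^-1 ^+ a + 2^-1 ^+ b.
Proof.
move=> ac ce; have h k : 0 < (2^-1 : R) ^+ k by rewrite exprn_gt0 // invr_gt0.
have := pow2V_lt R ac; have := pow2V_lt R ce; have := h c; have := h e; have := h b; lra.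
Qed.

(** The larger of the two powers is at least twice each of the smaller ones, so it
    is determined by the sum. *)
Lemma pow2V_sum_sorted (R : realFieldType) (a b c e : nat) : (a < b)%N -> (c < e)%N ->
  (2^-1 : R) ^+ a + 2^-1 ^+ b = 2^-1 ^+ c + 2^-1 ^+ e -> a = c /\ b = e.
Proof.
move=> ab ce E.
have [ac|ca|ac] := ltngtP a c.
- by have := pow2V_sum_lt R b ac ce; rewrite E ltxx.
- by have := pow2V_sum_lt R e ca ab; rewrite E ltxx.
split=> //; move: E; rewrite ac => /addrI /eqP.
rewrite -subr_eq0 => E; apply: contraTeq E => be; rewrite subr_eq0.
have h k : 0 < (2^-1 : R) ^+ k by rewrite exprn_gt0 // invr_gt0.
move: be; rewrite neq_ltn => /orP[] /(pow2V_lt R) le.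
  by rewrite gt_eqF //; have := h e; lra.
by rewrite lt_eqF //; have := h b; lra.
Qed.

Lemma pow2V_sum_inj (R : realFieldType) (a b c e : nat) : a <> b -> c <> e ->
  (2^-1 : R) ^+ a + 2^-1 ^+ b = 2^-1 ^+ c + 2^-1 ^+ e ->
  a = c /\ b = e \/ a = e /\ b = c.
Proof.
move=> /eqP; rewrite neq_ltn => /orP[] ab /eqP; rewrite neq_ltn => /orP[] ce E.
- by left; exact: pow2V_sum_sorted E.
- by right; apply: (@pow2V_sum_sorted R _ _ _ _ ab ce); rewrite E addrC.
- by right; apply/and_comm; apply: (@pow2V_sum_sorted R _ _ _ _ ab ce); rewrite addrC E.
- by left; apply/and_comm; apply: (@pow2V_sum_sorted R _ _ _ _ ab ce); rewrite addrC E addrC.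
Qed.

End PowerSums.

Section Tilts.
Context {R : realType}.

(** The enumeration of the pairs of integers gives distinct exponents; the factor
    1/8 keeps the hexagons convex. *)
Definition tilt (m n : int) : R := 1 / 8 * 2^-1 ^+ pickle (m, n).

Lemma tilt_gt0 m n : 0 < tilt m n.
Proof. by rewrite mulr_gt0 // exprn_gt0 // invr_gt0. Qed.

Lemma tilt_le m n : tilt m n <= 1 / 8.
Proof.
by rewrite ger_pMr // exprn_ile1 // ?invr_ge0 ?invf_le1 ?ler1n.
Qed.

(** The set of the indices of the bottom and top tilts determines the hexagon:
    two hexagons that use the same two tilts in opposite roles would each
    be above the other. *)
Lemma tilt_hex_congruent m n m' n' :
  congruent (hex tilt m n) (hex tilt m' n') -> (m, n) = (m', n').
Proof.
have ne (a b : int) : pickle (a, b) <> pickle (a + 1, b - 1).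
  by move/(pcan_inj pickleK) => -[]; lia.
have c0 : 1 / 8 != 0 :> R by rewrite div1r invr_eq0 pnatr_eq0.
move/(hex_congruent tilt_gt0 tilt_le); rewrite /tilt -!mulrDr => /(mulfI c0).
case/(pow2V_sum_inj (ne _ _) (ne _ _)); first by case=> /(pcan_inj pickleK).
by case=> /(pcan_inj pickleK)[e1 _] /(pcan_inj pickleK)[e2 _]; lia.
Qed.

End Tilts.

Theorem theorem5 (R : realType) :
  exists T : set (set (R * R)),
    [/\ tiling T, normal_tiling T, vertex_to_vertex T,
        pairwise_noncongruent T
      & forall A, T A -> convex_polygon 6 A /\ area A = 1%E] /\
    exists Q : set (set (R * R)),
      [/\ tiling Q,
          forall P, Q P -> nonconvex_polygon 14 P,
          forall P, Q P -> exists h : 'I_4 -> set (R * R),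
            dissected_into_four T P h
        & forall A, T A -> exists P (h : 'I_4 -> set (R * R)),
            [/\ Q P, dissected_into_four T P h & exists i, A = h i]].
Proof.
pose d : int -> int -> R := tilt.
have d0 : forall m n, 0 < d m n by exact: tilt_gt0.
have d8 : forall m n, d m n <= 1 / 8 by exact: tilt_le.
pose H (h : int * int) := hex d h.1 h.2.
(* Blocks start at pairs of even integers, so that every index is in exactly one
   of them. *)
pose G (h : int * int) := gon d (2 * h.1) (2 * h.2).
have cv := hex_vertex_strictly_convex d0 d8.
have Hpoly h : polygon_with (hex_vertex d h.1 h.2) (H h) by exact: polygon_with_region.
have Hc h h' : congruent (H h) (H h') -> h = h'.
  by move: h h' => [m n] [m' n']; exact: tilt_hex_congruent.
have int_interior h h' : h <> h' -> (H h)° `&` (H h')° = set0.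
  move=> ne; rewrite -subset0 -interiorI => x xI.
  have [||||k []] := @hex_open_overlap _ d d0 d8 [set h] [set h'] ((H h `&` H h')°).
  - exact: open_interior.
  - by move=> y /interior_subset[hy _]; exists h.
  - by move=> y /interior_subset[_ hy]; exists h'.
  - by exists x.
  - by move=> -> /=; exact: ne.
have parity (m : int) : exists a, m = 2 * a \/ m = 2 * a + 1 by exists (m %/ 2)%Z; lia.
have dissect h : exists k : 'I_4 -> int * int, injective k /\
    range k = block (2 * h.1) (2 * h.2).
  pose s := [:: (2 * h.1, 2 * h.2); (2 * h.1 + 1, 2 * h.2);
     (2 * h.1, 2 * h.2 + 1); (2 * h.1 + 1, 2 * h.2 + 1)].
  exists (fun i : 'I_4 => nth (0, 0) s i); split.
    move=> i j /eqP; rewrite nth_uniq //; first by move/eqP; exact: val_inj.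
    by rewrite /s /= !inE /= !xpair_eqE; lia.
  apply/seteqP; split=> x.
    by case=> -[[|[|[|[|i]]]] hi] // _ <-; rewrite /block /=; lia.
  case: x => x y [/= [->|->] [->|->]].
  - by exists (inord 0); rewrite //= inordK.
  - by exists (inord 2); rewrite //= inordK.
  - by exists (inord 1); rewrite //= inordK.
  - by exists (inord 3); rewrite //= inordK.
have Gdiss h k : injective k -> range k = block (2 * h.1) (2 * h.2) ->
    dissected_into_four (range H) (G h) (H \o k).
  move=> kinj kr; split.
  - by move=> i; exists (k i).
  - by move=> i j ij /Hc/kinj e; rewrite e eqxx in ij.
  - by rewrite /G /gon -kr bigcup_image.
exists (range H); split; first split.
- split.
  + exact: sub_countable (card_image_le _ _) (countableP _).
  + by move=> _ [h _ <-]; apply: region_compact.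
  + by move=> _ _ [h _ <-] [h' _ <-] ne; apply: int_interior => e; apply: ne; rewrite e.
  + apply/seteqP; split=> // x _; have [m [n hx]] := hex_cover d0 d8 x.
    by exists (H (m, n)) => //; exists (m, n).
- exists (1 / 8), 2; split; [by lra|by lra| |].
  + by move=> _ [h _ <-]; exists (hex_center h.1 h.2); exact: hex_contains_ball.
  + by move=> _ [h _ <-]; exists (hex_center h.1 h.2); exact: hex_in_ball.
- move=> _ _ [[m n] _ <-] [[m' n'] _ <-] ne.
  have [I0|/set0P[x [hx hx']]] := eqVneq (H (m, n) `&` H (m', n')) set0; first by constructor 3.
  have [e|i [e1 e2]] := hex_meet d0 d8 hx hx'; first by case: ne; exact: (congr1 H e).
  rewrite /= in e1 e2; subst m' n'; constructor 1; rewrite hex_nb //; split.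
    by exists 6, (hex_vertex d m n); split; [exact: (Hpoly (m, n))|exists i].
  exists 6, (hex_vertex d (m + nbm i) (n + nbn i)).
  split; first exact: (Hpoly (m + nbm i, n + nbn i)).
  by exists (ordS (ordS (ordS i))); rewrite side_nb.
- by move=> _ _ [h _ <-] [h' _ <-] ne /Hc e; apply: ne; rewrite e.
- move=> _ [h _ <-]; split; last exact: area_hex.
  split; first by exists (hex_vertex d h.1 h.2).
  by apply/convex_setP; exact: region_segment_closed.
exists (range G); split.
- split.
  + exact: sub_countable (card_image_le _ _) (countableP _).
  + by move=> _ [h _ <-]; apply: boxed_compact; [exact: hexes_closed|exact: gon_boxed].
  + move=> _ _ [h _ <-] [h' _ <-] ne; rewrite -subset0 -interiorI => x xI.
    have [||||k []] := @hex_open_overlap _ d d0 d8 (block (2 * h.1) (2 * h.2))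
       (block (2 * h'.1) (2 * h'.2)) ((G h `&` G h')°).
    * exact: open_interior.
    * by move=> y /interior_subset[].
    * by move=> y /interior_subset[].
    * by exists x.
    * rewrite /block /= => a b; apply: ne; congr G.
      by rewrite (surjective_pairing h) (surjective_pairing h'); congr pair; lia.
  + apply/seteqP; split=> // x _; have [m [n hx]] := hex_cover d0 d8 x.
    have [a ma] := parity m; have [b nb] := parity n.
    by exists (G (a, b)); [exists (a, b)|exists (m, n)].
- by move=> _ [h _ <-]; split; [exact: gon_polygon|exact: gon_nonconvex].
- by move=> _ [h _ <-]; have [k [kinj kr]] := dissect h; exists (H \o k); exact: Gdiss.
- move=> _ [[m n] _ <-]; have [a ma] := parity m; have [b nb] := parity n.
  have [k [kinj kr]] := dissect (a, b).
  have [i _ ki] : range k (m, n) by rewrite kr.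
  by exists (G (a, b)), (H \o k); split; [exists (a, b)|exact: Gdiss|exists i; rewrite /= ki].
Qed.
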